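(* For every $\delta>0$ there exists $K_0>0$ such that for every pair of integers $(k_1,k_2)$ with $k_1\ge K_0$, $k_2\ge K_0$, $k_1\ge\delta k_2$ and $k_2\ge\delta k_1$, there exists a nonnegative integer $n$ with $s_2(n)=k_1$ and $s_3(n)=k_2$.
   Context: For an integer base $q\ge2$ and an integer $n\ge0$, $s_q(n)$ denotes the sum of the digits of $n$ in base $q$. *)

(* Defs.v *)
From Stdlib Require Import Arith Reals Lia.

(* Sum of base-q digits of n, for q >= 2.  Defined by recursion with fuel
   (n itself suffices as fuel since n / q < n for n > 0, q >= 2). *)
Fixpoint digit_sum_aux (fuel q n : nat) : nat :=
  match fuel with
  | O => 0
  | S f => match n with
           | O => 0
           | _ => n mod q + digit_sum_aux f q (n / q)
           end
  end.

Definition digit_sum (q n : nat) : nat := digit_sum_aux (S n) q n.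

Example ds_2_7 : digit_sum 2 7 = 3. Proof. reflexivity. Qed.
Example ds_3_8 : digit_sum 3 8 = 4. Proof. reflexivity. Qed.
Example ds_10_1234 : digit_sum 10 1234 = 10. Proof. reflexivity. Qed.

(* Main.v *)
Require Import Defs.
From Stdlib Require Import Reals.
From Stdlib Require Import Lra Lia Psatz ZArith Arith List Permutation Znumtheory Zpow_facts.
Open Scope R_scope.

(** If M is a multiple of 6^c and r < 2^c, then the digit sums of M + r in bases 2 and 3 are those
    of M plus those of r.  Hence it suffices (i) to find many r < 2^c whose pairs of digit sums fill
    a box of side proportional to c, and (ii) to hit any target (k1, k2) up to a small multiple of
    c by the pair of a multiple M of 6^c, where c is a small multiple of max(k1, k2).

    For (i), a box is enlarged by a factor 20 at the cost of a factor 20 in c.  One prescribes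
    low digits of a number N by the Chinese remainder theorem so that each of 400 increments
    changes both digit sums by prescribed amounts: an increment creates carries through a run of
    maximal digits, and the lengths of the runs absorb the unavoidable random contribution of the
    higher digits, which is only of order sqrt c by Chebyshev's inequality.

    For (ii), let {q1, q2} = {2, 3} with q1 the base of the smaller target.  Take n with digits in
    base q1 prescribed except for a sparse set of short blocks, which are random.  Since
    s_q2(n) = (q2 - 1) sum_j {n / q2^j}, a second moment computation shows that s_q2(n) is close to
    its typical value: varying the block just above the position j equidistributes {n / q2^j}
    unless q1^i / q2^j is very close to a rational with small denominator, and as
    log q1 / log q2 is irrational this happens for few j.  A last correction at the low
    positions, with typical digits, makes the number divisible by 6^c. *)

(** * Finite sums and counting *)

(** In (i) each base is treated alone: the carries stay inside a prescribed residue, and the unknown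
    digits above it only add a constant, the same for all increments, so the two residues can be
    glued afterwards. In (ii) the digit sum in base q1 is set by hand, and only base q2 needs the
    second moment. The smaller target k1 belongs to base q1 for this reason: numbers with L digits
    in base q1 typically have s_q2 near rho L with rho <= 4/5, so reaching k2 takes L > k2 >= k1
    digits, and the digits 0 and 1 alone produce k1. The second moment must not deteriorate as the
    spacing D of the random blocks grows. The positions to avoid, where q1^i / q2^j is near m/d,
    form arcs of width proportional to 1/(m D); m runs up to a multiple of q1^D, so the harmonic sum
    is of order D and the total stays bounded. The ratio c0 of c to the side of the box is fixed
    first; the tolerance of the second moment is then taken small against 1/c0, and the targets
    large last. *)

Fixpoint rsum (f : nat -> R) (n : nat) : R :=
  match n with O => 0 | S k => rsum f k + f k end.

Lemma rsum_ext f g n : (forall i, (i < n)%nat -> f i = g i) -> rsum f n = rsum g n.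
Proof.
  induction n as [|n IH]; intros H; simpl; [reflexivity|].
  rewrite IH, H; auto.
Qed.

Lemma rsum_le f g n : (forall i, (i < n)%nat -> f i <= g i) -> rsum f n <= rsum g n.
Proof.
  induction n as [|n IH]; intros H; simpl; [lra|].
  apply Rplus_le_compat; auto.
Qed.

Lemma rsum_plus f g n : rsum (fun i => f i + g i) n = rsum f n + rsum g n.
Proof. induction n as [|n IH]; simpl; [|rewrite IH]; lra. Qed.

Lemma rsum_scal c f n : rsum (fun i => c * f i) n = c * rsum f n.
Proof. induction n as [|n IH]; simpl; [|rewrite IH]; lra. Qed.

Lemma rsum_const c n : rsum (fun _ => c) n = INR n * c.
Proof. induction n as [|n IH]; [simpl; lra|]. rewrite S_INR; simpl rsum; rewrite IH; lra. Qed.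

Lemma rsum_nonneg f n : (forall i, (i < n)%nat -> 0 <= f i) -> 0 <= rsum f n.
Proof.
  intros H. replace 0 with (rsum (fun _ => 0) n) by (rewrite rsum_const; lra).
  now apply rsum_le.
Qed.

Lemma rsum_abs f n : Rabs (rsum f n) <= rsum (fun i => Rabs (f i)) n.
Proof.
  induction n as [|n IH]; simpl; [rewrite Rabs_R0; lra|].
  eapply Rle_trans; [apply Rabs_triang|]; lra.
Qed.

Lemma rsum_swap f n m :
  rsum (fun i => rsum (fun j => f i j) m) n = rsum (fun j => rsum (fun i => f i j) n) m.
Proof.
  induction n as [|n IH]; simpl.
  - induction m as [|m IHm]; simpl; lra.
  - now rewrite IH, rsum_plus.
Qed.

Lemma rsum_add f n m : rsum f (n + m) = rsum f n + rsum (fun i => f (n + i)%nat) m.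
Proof.
  induction m as [|m IH]; [rewrite Nat.add_0_r; simpl; lra|].
  rewrite Nat.add_succ_r; simpl; rewrite IH; lra.
Qed.

Lemma rsum_mul f a b :
  rsum f (a * b) = rsum (fun i => rsum (fun j => f (i * b + j)%nat) b) a.
Proof.
  induction a as [|a IH]; simpl; [reflexivity|].
  rewrite Nat.add_comm, rsum_add, IH; reflexivity.
Qed.

Lemma rsum_term_le f n i :
  (forall i, (i < n)%nat -> 0 <= f i) -> (i < n)%nat -> f i <= rsum f n.
Proof.
  induction n as [|n IH]; intros H Hi; [lia|]; simpl.
  pose proof (H n (Nat.lt_succ_diag_r n)).
  assert (0 <= rsum f n) by (apply rsum_nonneg; auto).
  destruct (Nat.eq_dec i n) as [->|]; [lra|].
  assert (f i <= rsum f n) by (apply IH; [auto|lia]). lra.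
Qed.

Lemma rsum_sq f n : rsum f n * rsum f n = rsum (fun i => rsum (fun j => f i * f j) n) n.
Proof.
  rewrite <- rsum_scal; apply rsum_ext; intros.
  rewrite rsum_scal; lra.
Qed.

Lemma rsum_exists_le f n b :
  (0 < n)%nat -> rsum f n <= INR n * b -> exists i, (i < n)%nat /\ f i <= b.
Proof.
  induction n as [|n IH]; intros Hn H; [lia|].
  destruct (Rle_dec (f n) b) as [Hf|Hf]; [exists n; auto|].
  rewrite S_INR in H; simpl in H.
  destruct n as [|n]; [simpl in H; lra|].
  destruct IH as [i [Hi Hb]]; [lia|lra|].
  exists i; split; [lia|auto].
Qed.

Lemma rsum_list f n : rsum f n = fold_right Rplus 0 (map f (seq 0 n)).
Proof.
  induction n as [|n IH]; [reflexivity|].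
  rewrite seq_S, map_app, fold_right_app; simpl.
  rewrite IH. generalize (map f (seq 0 n)) as l.
  induction l as [|x l IHl]; simpl; lra.
Qed.

Lemma fold_right_Rplus_perm (l l' : list R) :
  Permutation l l' -> fold_right Rplus 0 l = fold_right Rplus 0 l'.
Proof. induction 1; simpl; lra. Qed.

Lemma NoDup_map_seq (h : nat -> nat) n :
  (forall i j, (i < n)%nat -> (j < n)%nat -> h i = h j -> i = j) -> NoDup (map h (seq 0 n)).
Proof.
  intros H. apply NoDup_map_NoDup_ForallPairs; [|apply seq_NoDup].
  intros i j Hi Hj E. apply in_seq in Hi, Hj. apply H; lia || auto.
Qed.

Lemma rsum_perm f h n :
  (forall i, (i < n)%nat -> (h i < n)%nat) ->
  (forall i j, (i < n)%nat -> (j < n)%nat -> h i = h j -> i = j) ->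
  rsum (fun i => f (h i)) n = rsum f n.
Proof.
  intros Hr Hi. rewrite !rsum_list, <- (map_map h f).
  apply fold_right_Rplus_perm, Permutation_map, NoDup_Permutation_bis.
  - now apply NoDup_map_seq.
  - now rewrite length_map.
  - intros x Hx. apply in_map_iff in Hx as [y [<- Hy]].
    apply in_seq in Hy. apply in_seq. specialize (Hr y); lia.
Qed.

Lemma nat_above x : exists n : nat, x <= INR n.
Proof.
  exists (Z.to_nat (up x)). rewrite INR_IZR_INZ.
  destruct (archimed x) as [Hx _]. apply Rle_trans with (IZR (up x)); [lra|apply IZR_le; lia].
Qed.

Lemma pigeonhole_nat (h : nat -> nat) n :
  (forall i, (i <= n)%nat -> (h i < n)%nat) ->
  exists i j, (i < j <= n)%nat /\ h i = h j.
Proof.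
  intros Hr.
  destruct (ListDec.NoDup_dec Nat.eq_dec (map h (seq 0 (S n)))) as [H|H].
  - assert (length (map h (seq 0 (S n))) <= length (seq 0 n))%nat.
    { apply NoDup_incl_length; [exact H|].
      intros x Hx. apply in_map_iff in Hx as [y [<- Hy]].
      apply in_seq in Hy. apply in_seq. specialize (Hr y); lia. }
    rewrite length_map, !length_seq in H0; lia.
  - destruct (Classical_Prop.classic (exists i j, (i < j <= n)%nat /\ h i = h j)) as [|N]; [auto|].
    exfalso; apply H, NoDup_map_seq. intros i j Hi Hj E.
    destruct (Nat.lt_trichotomy i j) as [L|[L|L]]; auto; exfalso; apply N;
      [exists i, j|exists j, i]; split; auto; lia.
Qed.

Definition indic (b : bool) : R := if b then 1 else 0.

Lemma indic_nonneg b : 0 <= indic b. Proof. destruct b; simpl; lra. Qed.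
Lemma indic_le1 b : indic b <= 1. Proof. destruct b; simpl; lra. Qed.

(** All hits lie in the window of length [d] that ends at the last one; the case [i = j] of the
    hypothesis gives [0 < d] as soon as there is a hit. *)
Lemma count_close (P : nat -> bool) n d :
  (forall i j, (i <= j < n)%nat -> P i = true -> P j = true -> (j < i + d)%nat) ->
  rsum (fun i => indic (P i)) n <= INR d.
Proof.
  revert d. induction n as [|n IH]; intros d H; simpl; [apply pos_INR|].
  destruct (P n) eqn:E; simpl indic.
  - assert (Hd : (0 < d)%nat) by (specialize (H n n); lia || (specialize (H ltac:(lia) E E); lia)).
    destruct d as [|d]; [lia|]. rewrite S_INR.
    apply Rplus_le_compat_r.
    assert (Hc : rsum (fun i => indic (P i)) (n - d) <= 0).
    { replace 0 with (rsum (fun _ => 0) (n - d)) by (rewrite rsum_const; lra).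
      apply rsum_le. intros i Hi. destruct (P i) eqn:Ei; simpl; [|lra].
      specialize (H i n ltac:(lia) Ei E); lia. }
    replace n with ((n - d) + (n - (n - d)))%nat at 1 by lia.
    rewrite rsum_add.
    assert (rsum (fun i => indic (P (n - d + i)%nat)) (n - (n - d)) <= INR (n - (n - d)) * 1).
    { rewrite <- rsum_const. apply rsum_le; intros; apply indic_le1. }
    assert (INR (n - (n - d)) <= INR d) by (apply le_INR; lia). lra.
  - rewrite Rplus_0_r. apply IH. intros i j Hij; apply H; lia.
Qed.

Lemma count_spaced (P : nat -> bool) g n m :
  (0 < g)%nat -> (n <= m * g)%nat ->
  (forall i j, (i < j)%nat -> P i = true -> P j = true -> (i + g <= j)%nat) ->
  rsum (fun i => indic (P i)) n <= INR m.
Proof.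
  intros Hg Hn H.
  apply Rle_trans with (rsum (fun i => indic (P i)) (m * g)).
  { replace (m * g)%nat with (n + (m * g - n))%nat by lia. rewrite rsum_add.
    assert (0 <= rsum (fun i => indic (P (n + i)%nat)) (m * g - n))
      by (apply rsum_nonneg; intros; apply indic_nonneg). lra. }
  rewrite rsum_mul. replace (INR m) with (INR m * INR 1) by (simpl; lra).
  rewrite <- rsum_const. apply rsum_le. intros i Hi.
  apply (count_close (fun j => P (i * g + j)%nat)).
  intros a b Hab Ha Hb. destruct (Nat.eq_dec a b) as [|N]; [lia|].
  specialize (H (i * g + a)%nat (i * g + b)%nat ltac:(lia) Ha Hb). lia.
Qed.

(** Group the terms by the value of [F]. This transfers a mean over a complete range of digit blocks
    to the values of [F], at the cost of their largest multiplicity. *)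
Lemma rsum_fibres (F : nat -> nat) (psi : nat -> R) T H M :
  (forall h, 0 <= psi h) ->
  (forall t, (t < T)%nat -> (F t < H)%nat) ->
  (forall h, (h < H)%nat -> rsum (fun t => indic (F t =? h)%nat) T <= M) ->
  rsum (fun t => psi (F t)) T <= M * rsum psi H.
Proof.
  intros Hp HF HM.
  apply Rle_trans with (rsum (fun t => rsum (fun h => indic (F t =? h)%nat * psi h) H) T).
  - apply rsum_le. intros t Ht.
    replace (psi (F t)) with (indic (F t =? F t)%nat * psi (F t))
      by (rewrite Nat.eqb_refl; simpl; lra).
    apply (rsum_term_le (fun h => indic (F t =? h)%nat * psi h)); auto.
    intros; apply Rmult_le_pos; auto using indic_nonneg.
  - rewrite rsum_swap, <- rsum_scal. apply rsum_le. intros h Hh.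
    rewrite (rsum_ext _ (fun t => psi h * indic (F t =? h)%nat)) by (intros; lra).
    rewrite rsum_scal, Rmult_comm. apply Rmult_le_compat_r; auto.
Qed.

(** * Digit sums *)

Local Open Scope nat_scope.

Lemma digit_sum_aux_fuel q f g n :
  2 <= q -> n < f -> n < g -> digit_sum_aux f q n = digit_sum_aux g q n.
Proof.
  intros Hq. revert g n. induction f as [|f IH]; intros g n Hf Hg; [lia|].
  destruct g as [|g]; [lia|]. simpl. destruct n as [|n]; [reflexivity|].
  f_equal. assert (S n / q < S n) by (apply Nat.div_lt; lia).
  apply IH; lia.
Qed.

Lemma digit_sum_0 q : digit_sum q 0 = 0.
Proof. reflexivity. Qed.

Lemma digit_sum_step q n : 2 <= q -> digit_sum q n = n mod q + digit_sum q (n / q).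
Proof.
  intros Hq. destruct n as [|n].
  - rewrite Nat.Div0.mod_0_l, Nat.Div0.div_0_l. reflexivity.
  - assert (S n / q < S n) by (apply Nat.div_lt; lia).
    change (S n mod q + digit_sum_aux (S n) q (S n / q) = S n mod q + digit_sum q (S n / q)).
    f_equal. apply digit_sum_aux_fuel; lia.
Qed.

Lemma digit_sum_cons q m d : 2 <= q -> d < q -> digit_sum q (m * q + d) = digit_sum q m + d.
Proof.
  intros Hq Hd. rewrite digit_sum_step by auto.
  rewrite (Nat.add_comm (m * q)), Nat.Div0.mod_add, Nat.mod_small by auto.
  rewrite Nat.div_add, Nat.div_small by lia. simpl; lia.
Qed.

Lemma digit_sum_small q d : 2 <= q -> d < q -> digit_sum q d = d.
Proof. intros. exact (digit_sum_cons q 0 d H H0). Qed.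

Lemma digit_sum_app q c m r :
  2 <= q -> r < q ^ c -> digit_sum q (m * q ^ c + r) = digit_sum q m + digit_sum q r.
Proof.
  intros Hq. revert m r. induction c as [|c IH]; intros m r Hr.
  - simpl in *. replace r with 0 by lia. rewrite digit_sum_0, Nat.mul_1_r, !Nat.add_0_r. reflexivity.
  - assert (Hd : r mod q < q) by (apply Nat.mod_upper_bound; lia).
    assert (Hr' : r / q < q ^ c) by (apply Nat.Div0.div_lt_upper_bound; rewrite Nat.pow_succ_r' in Hr; exact Hr).
    pose proof (Nat.div_mod_eq r q) as E.
    replace (m * q ^ S c + r) with ((m * q ^ c + r / q) * q + r mod q)
      by (rewrite Nat.pow_succ_r'; transitivity (m * q ^ c * q + (q * (r / q) + r mod q));
          [ring|rewrite <- E; ring]).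
    rewrite digit_sum_cons, IH by auto.
    rewrite (digit_sum_step q r) by auto. lia.
Qed.

Lemma digit_sum_mul_pow q c m : 2 <= q -> digit_sum q (m * q ^ c) = digit_sum q m.
Proof.
  intros Hq. rewrite <- (Nat.add_0_r (m * q ^ c)), digit_sum_app by (auto; apply Nat.neq_0_lt_0, Nat.pow_nonzero; lia).
  rewrite digit_sum_0; lia.
Qed.

Lemma digit_sum_bound q c r : 2 <= q -> r < q ^ c -> digit_sum q r <= (q - 1) * c.
Proof.
  intros Hq. revert r. induction c as [|c IH]; intros r Hr.
  - simpl in Hr. replace r with 0 by lia. rewrite digit_sum_0; lia.
  - assert (Hd : r mod q < q) by (apply Nat.mod_upper_bound; lia).
    assert (Hr' : r / q < q ^ c) by (apply Nat.Div0.div_lt_upper_bound; rewrite Nat.pow_succ_r' in Hr; exact Hr).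
    rewrite digit_sum_step by auto. specialize (IH _ Hr').
    rewrite Nat.mul_succ_r. lia.
Qed.

Lemma npow_pos q c : 2 <= q -> 0 < q ^ c.
Proof. intros; apply Nat.neq_0_lt_0, Nat.pow_nonzero; lia. Qed.

Lemma digit_sum_pow_pred q c : 2 <= q -> digit_sum q (q ^ c - 1) = (q - 1) * c.
Proof.
  intros Hq. induction c as [|c IH]; [simpl; now rewrite digit_sum_0, Nat.mul_0_r|].
  pose proof (npow_pos q c Hq).
  replace (q ^ S c - 1) with ((q ^ c - 1) * q + (q - 1)).
  - rewrite digit_sum_cons, IH by lia. nia.
  - simpl. nia.
Qed.

Lemma digit_sum_pow q c : 2 <= q -> digit_sum q (q ^ c) = 1.
Proof.
  intros Hq. rewrite <- (Nat.mul_1_l (q ^ c)), digit_sum_mul_pow by auto.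
  apply digit_sum_small; lia.
Qed.

Lemma digit_sum_mod q n : 2 <= q -> exists k, n = digit_sum q n + k * (q - 1).
Proof.
  intros Hq. induction n as [n IH] using (well_founded_induction Nat.lt_wf_0).
  destruct (Nat.eq_dec n 0) as [->|N]; [exists 0; reflexivity|].
  assert (Hlt : n / q < n) by (apply Nat.div_lt; lia).
  destruct (IH _ Hlt) as [k Hk].
  rewrite digit_sum_step by auto.
  pose proof (Nat.div_mod_eq n q) as E.
  exists (k + n / q). nia.
Qed.

Fixpoint nsum (f : nat -> nat) (n : nat) : nat :=
  match n with O => 0 | S k => nsum f k + f k end.

Lemma nsum_ext f g n : (forall i, i < n -> f i = g i) -> nsum f n = nsum g n.
Proof.
  induction n as [|n IH]; intros H; simpl; [reflexivity|].
  rewrite IH, H; auto.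
Qed.

(** Blocks of [h] digits placed side by side from position [e] on produce no carry. The spare
    [q ^ e] in the first conjunct leaves room for a summand below that position. *)
Lemma digit_sum_blocks q h e (a : nat -> nat) n :
  2 <= q -> (forall l, l < n -> a l < q ^ h) ->
  nsum (fun l => a l * q ^ (e + h * l)) n + q ^ e <= q ^ (e + h * n) /\
  digit_sum q (nsum (fun l => a l * q ^ (e + h * l)) n) = nsum (fun l => digit_sum q (a l)) n.
Proof.
  intros Hq. induction n as [|n IH]; intros Ha.
  - simpl. rewrite Nat.mul_0_r, Nat.add_0_r. split; [lia|reflexivity].
  - destruct IH as [IH1 IH2]; [auto|]. simpl nsum.
    pose proof (npow_pos q e Hq). pose proof (npow_pos q (e + h * n) Hq).
    specialize (Ha n ltac:(lia)).
    replace (e + h * S n) with (h + (e + h * n)) by lia. rewrite (Nat.pow_add_r q h).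
    split; [pose proof (Nat.mul_le_mono_r (S (a n)) (q ^ h) (q ^ (e + h * n)) Ha) as HH; rewrite Nat.mul_succ_l in HH; lia|].
    rewrite (Nat.add_comm (nsum _ n)), digit_sum_app, IH2 by (auto; lia). lia.
Qed.

Lemma crt a b x y : rel_prime (Z.of_nat a) (Z.of_nat b) -> 0 < a -> 0 < b ->
  exists n, n < a * b /\ n mod a = x mod a /\ n mod b = y mod b.
Proof.
  intros Hr Ha Hb.
  apply rel_prime_bezout in Hr as [u v Huv].
  set (n := ((Z.of_nat x * (v * Z.of_nat b) + Z.of_nat y * (u * Z.of_nat a)) mod (Z.of_nat a * Z.of_nat b))%Z).
  assert (Hn : (0 <= n < Z.of_nat a * Z.of_nat b)%Z) by (apply Z.mod_pos_bound; nia).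
  exists (Z.to_nat n). split; [nia|].
  assert (E : exists k, (n = Z.of_nat x * (v * Z.of_nat b) + Z.of_nat y * (u * Z.of_nat a) + k * (Z.of_nat a * Z.of_nat b))%Z).
  { unfold n. rewrite Z.mod_eq by nia.
    match goal with |- context [(?p / ?q)%Z] => exists (- (p / q))%Z end. ring. }
  destruct E as [k E].
  split; apply Nat2Z.inj; rewrite !Nat2Z.inj_mod, Z2Nat.id by lia.
  - replace n with (Z.of_nat x + ((Z.of_nat y * u - Z.of_nat x * u + k * Z.of_nat b) * Z.of_nat a))%Z by nia.
    apply Z.mod_add; lia.
  - replace n with (Z.of_nat y + ((Z.of_nat x * v - Z.of_nat y * v + k * Z.of_nat a) * Z.of_nat b))%Z by nia.
    apply Z.mod_add; lia.
Qed.

Lemma rel_prime_2_3 a b : rel_prime (Z.of_nat (2 ^ a)) (Z.of_nat (3 ^ b)).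
Proof.
  rewrite !Nat2Z.inj_pow. apply rel_prime_Zpower; try lia.
  apply Zgcd_1_rel_prime; reflexivity.
Qed.
Close Scope nat_scope.

(* Twice the deviation of the digit sum from its mean (q - 1) m / 2 on m digits. *)
Definition dev (q m n : nat) : R := 2 * INR (digit_sum q n) - INR (q - 1) * INR m.

(** The digits of a uniform number below [q ^ m] are independent and variances add. One digit has
    mean square 1 for q = 2 and 8/3 for q = 3; the constant 3 covers both. *)
Lemma rsum_dev_sq q m : (q = 2 \/ q = 3)%nat ->
  rsum (fun z => (dev q m z) ^ 2) (q ^ m) <= INR (q ^ m) * (3 * INR m).
Proof.
  intros Hq. induction m as [|m IH].
  - simpl. unfold dev; simpl. lra.
  - replace (q ^ S m)%nat with (q ^ m * q)%nat by (simpl; lia).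
    rewrite rsum_mul, mult_INR.
    apply Rle_trans with (rsum (fun z => INR q * (dev q m z) ^ 2 + 3 * INR q) (q ^ m)).
    + apply rsum_le. intros z Hz. unfold dev.
      rewrite (S_INR m). destruct Hq as [->| ->]; cbn [rsum]; rewrite !digit_sum_cons by lia;
        rewrite !plus_INR; simpl (INR _ ); cbn [INR Nat.sub]; nra.
    + rewrite rsum_plus, rsum_scal, rsum_const, S_INR.
      assert (0 < INR q) by (destruct Hq as [->| ->]; simpl; lra). nra.
Qed.

(** * Boxes of attained pairs *)

(** Average over [X]: the numbers [X + E l] are distinct and below [2 * q ^ m], hence have at most
    [m + 1] digits. Summing over the [K] indices and losing a factor [q <= 3] for the extra digit
    gives the 9. *)
Lemma noise q K m (E : nat -> nat) :
  (q = 2 \/ q = 3)%nat -> (forall l, (l < K)%nat -> (E l < q ^ m)%nat) ->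
  exists X, (X < q ^ m)%nat /\
    forall l, (l < K)%nat -> (dev q (m + 1) (X + E l)) ^ 2 <= 9 * INR K * INR (m + 1).
Proof.
  intros Hq HE.
  destruct (rsum_exists_le (fun X => rsum (fun l => (dev q (m + 1) (X + E l)) ^ 2) K)
              (q ^ m) (9 * INR K * INR (m + 1))) as [X [HX HS]].
  - apply npow_pos; lia.
  - rewrite rsum_swap.
    apply Rle_trans with (rsum (fun _ => INR (q ^ (m + 1)) * (3 * INR (m + 1))) K).
    + apply rsum_le. intros l Hl. specialize (HE l Hl).
      eapply Rle_trans; [|apply rsum_dev_sq; auto].
      replace (q ^ (m + 1))%nat with (E l + (q ^ m + (q ^ (m + 1) - q ^ m - E l)))%nat
        by (rewrite Nat.add_1_r, Nat.pow_succ_r'; nia).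
      rewrite !rsum_add.
      rewrite (rsum_ext (fun i => dev q (m + 1) (E l + i) ^ 2) (fun X => dev q (m + 1) (X + E l) ^ 2))
        by (intros; now rewrite (Nat.add_comm (E l))).
      match goal with |- _ <= ?a + (_ + ?b) =>
        assert (0 <= a) by (apply rsum_nonneg; intros; apply pow2_ge_0);
        assert (0 <= b) by (apply rsum_nonneg; intros; apply pow2_ge_0) end. lra.
    + rewrite rsum_const. rewrite (Nat.add_comm m 1) at 1. rewrite Nat.pow_add_r, Nat.pow_1_r, mult_INR.
      assert (INR q <= 3) by (destruct Hq as [->| ->]; simpl; lra).
      pose proof (pos_INR K). pose proof (pos_INR (m + 1)). pose proof (pos_INR (q ^ m)).
      assert (0 <= INR K * INR (m + 1) * INR (q ^ m)) by (repeat apply Rmult_le_pos; auto).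
      nra.
  - exists X; split; auto. intros l Hl.
    eapply Rle_trans; [|exact HS].
    apply (rsum_term_le (fun l => dev q (m + 1) (X + E l) ^ 2)); auto.
    intros; apply pow2_ge_0.
Qed.

Lemma dev_close q m x y b :
  (dev q m x) ^ 2 <= (INR b) ^ 2 -> (dev q m y) ^ 2 <= (INR b) ^ 2 ->
  (digit_sum q x <= digit_sum q y + b)%nat.
Proof.
  intros Hx Hy. pose proof (pos_INR b).
  assert (dev q m x <= INR b) by nra.
  assert (- INR b <= dev q m y) by nra.
  unfold dev in *. apply INR_le. rewrite plus_INR. lra.
Qed.

Local Open Scope nat_scope.

Lemma nsum_update f g n l : l < n -> (forall i, i < n -> i <> l -> f i = g i) ->
  nsum f n + g l = nsum g n + f l.
Proof.
  induction n as [|n IH]; intros Hl H; [lia|]. simpl.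
  destruct (Nat.eq_dec l n) as [->|N].
  - rewrite (nsum_ext f g n) by (intros; apply H; lia). lia.
  - rewrite (H n) by lia. specialize (IH ltac:(lia) ltac:(auto)). lia.
Qed.

Lemma nsum_ge f n l : l < n -> f l <= nsum f n.
Proof.
  induction n as [|n IH]; intros Hl; [lia|]. simpl.
  destruct (Nat.eq_dec l n) as [->|N]; [lia|]. specialize (IH ltac:(lia)). lia.
Qed.

Lemma finite_choice (P : nat -> nat -> Prop) n :
  (forall l, l < n -> exists r, P l r) -> exists f, forall l, l < n -> P l (f l).
Proof.
  induction n as [|n IH]; intros H; [exists (fun _ => 0); intros; lia|].
  destruct IH as [f Hf]; [intros; apply H; lia|]. destruct (H n ltac:(lia)) as [r Hr].
  exists (fun l => if l =? n then r else f l). intros l Hl.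
  destruct (Nat.eqb_spec l n) as [->|]; [auto|apply Hf; lia].
Qed.

(** Parity check for base 3: [e] and [e0] stand for the digit sums of [x + f] and [x + f0],
    congruent to these modulo 2. So the offset that a run of digits 2 has to absorb is even, and
    half of it is a run length. *)
Lemma even_offset x f f0 e e0 k k0 t s :
  x + f = e + k * 2 -> x + f0 = e0 + k0 * 2 -> f mod 2 = f0 mod 2 -> t mod 2 = 0 ->
  e0 + t <= e + 2 * s -> (e + 2 * s - e0 - t) mod 2 = 0.
Proof.
  intros H1 H2 Hf Ht Hle.
  pose proof (Nat.div_mod_eq f 2). pose proof (Nat.div_mod_eq f0 2). pose proof (Nat.div_mod_eq t 2).
  replace (e + 2 * s - e0 - t) with ((f / 2 + k0 + s - (f0 / 2 + k + t / 2)) * 2).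
  - apply Nat.Div0.mod_mul.
  - set (u := f / 2) in *. set (v := f0 / 2) in *. set (w := t / 2) in *.
    rewrite Hf in *. rewrite Ht in *. clearbody u v w. generalize dependent (f0 mod 2). intros. lia.
Qed.

(* N0 carries, at position c + h l, a run of rho_l digits q - 1.  Adding T l, whose low part is
   q ^ (c + h l), destroys exactly the l-th run; the high part of T l changes the digit sum by an
   uncontrolled but nearly constant amount, which the choice of rho_l compensates exactly. *)
Lemma gadget q c h K M (T tau : nat -> nat) b tmax :
  q = 2 \/ q = 3 -> 0 < K ->
  (forall l, l < K -> T l mod q ^ (c + h * K) = q ^ (c + h * l)) ->
  (forall l, l < K -> T l / q ^ (c + h * K) < q ^ M) ->
  (forall l, l < K -> (T l / q ^ (c + h * K)) mod (q - 1) = (T 0 / q ^ (c + h * K)) mod (q - 1)) ->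
  (forall l, l < K -> tau l mod (q - 1) = 0) ->
  (forall l, l < K -> tau l <= tmax) -> tau 0 = 0 ->
  (9 * INR K * INR (M + 1) <= INR b ^ 2)%R ->
  3 * b + 2 * tmax < h ->
  exists N0, N0 mod q ^ c = 0 /\ N0 < q ^ (c + h * K + (M + 1)) /\
    forall top, exists C, forall l, l < K ->
      digit_sum q (top * q ^ (c + h * K + (M + 1)) + N0 + T l) = C + tau l.
Proof.
  intros Hq HK HT HF Hpar Htau Htmax Ht0 Hb Hh.
  set (G := c + h * K) in *.
  assert (Hq2 : 2 <= q) by lia.
  pose (F := fun l => T l / q ^ G).
  destruct (noise q K M F Hq HF) as [X [HX HN]].
  pose (e := fun l => digit_sum q (X + F l)).
  assert (He : forall l l', l < K -> l' < K -> e l <= e l' + b).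
  { intros l l' Hl Hl'. apply (dev_close q (M + 1)); eapply Rle_trans; eauto. }
  (* The run lengths solve [(q - 1) * rho = e l - e 0 - tau l + Q0]. As [e l] and [e 0] differ by at
     most [b], the right side is nonnegative and at most [3 * b + 2 * tmax < h]; the factor 2 keeps
     [Q0] even for q = 3. *)
  pose (Q0 := 2 * (b + tmax)).
  assert (Hrho : forall l, l < K -> exists rho, (q - 1) * rho + e 0 + tau l = e l + Q0 /\ rho < h).
  { intros l Hl. pose proof (He l 0 Hl HK). pose proof (He 0 l HK Hl).
    specialize (Htmax l Hl). specialize (Htau l Hl). specialize (Hpar l Hl).
    destruct Hq as [-> | ->].
    - exists (e l + Q0 - e 0 - tau l). unfold Q0 in *. lia.
    - simpl (3 - 1) in *.
      destruct (digit_sum_mod 3 (X + F l) Hq2) as [k1 Hk1].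
      destruct (digit_sum_mod 3 (X + F 0) Hq2) as [k2 Hk2].
      fold (e l) in Hk1. fold (e 0) in Hk2. simpl (3 - 1) in *.
      unfold F in Hk1, Hk2. unfold Q0 in *.
      exists ((e l + 2 * (b + tmax) - e 0 - tau l) / 2).
      pose proof (even_offset X _ _ _ _ k1 k2 _ (b + tmax) Hk1 Hk2 Hpar Htau ltac:(lia)) as Hev.
      pose proof (Nat.div_mod_eq (e l + 2 * (b + tmax) - e 0 - tau l) 2). lia. }
  assert (Hrho' : exists rho : nat -> nat, forall l, l < K -> (q - 1) * rho l + e 0 + tau l = e l + Q0 /\ rho l < h).
  { exact (finite_choice (fun l r => (q - 1) * r + e 0 + tau l = e l + Q0 /\ r < h) K Hrho). }
  clear Hrho. destruct Hrho' as [rho Hrho].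
  pose (a := fun l => q ^ rho l - 1).
  assert (Ha : forall l, l < K -> q ^ rho l < q ^ h).
  { intros l Hl. apply Nat.pow_lt_mono_r; [lia|apply Hrho; auto]. }
  assert (Hpp : forall l, 0 < q ^ rho l) by (intros; now apply npow_pos).
  exists (nsum (fun l => a l * q ^ (c + h * l)) K + X * q ^ G). split.
  { assert (E1 : forall n, exists k, nsum (fun l => a l * q ^ (c + h * l)) n = k * q ^ c).
    { induction n as [|n [k IH]]; [exists 0; reflexivity|]. simpl. rewrite IH, Nat.pow_add_r.
      exists (k + a n * q ^ (h * n)). ring. }
    destruct (E1 K) as [k ->]. unfold G. rewrite Nat.pow_add_r.
    replace (k * q ^ c + X * (q ^ c * q ^ (h * K))) with ((k + X * q ^ (h * K)) * q ^ c) by ring.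
    apply Nat.Div0.mod_mul. }
  split.
  { destruct (digit_sum_blocks q h c a K Hq2) as [B1 _].
    { intros l Hl. unfold a. specialize (Ha l Hl). lia. }
    fold G in B1. pose proof (npow_pos q c Hq2).
    rewrite (Nat.pow_add_r q G), Nat.add_1_r, Nat.pow_succ_r'. nia. }
  intros top.
  pose (R := nsum (fun l => (q - 1) * rho l) K).
  (* Makes the truncated subtraction in the constant below exact: since [tau 0 = 0], run 0 alone
     contributes [Q0]. *)
  assert (HR : Q0 <= R).
  { destruct (Hrho 0 HK) as [E _]. unfold R.
    pose proof (nsum_ge (fun l => (q - 1) * rho l) K 0 HK). simpl in H. lia. }
  exists (digit_sum q top + R + 1 + e 0 - Q0). intros l Hl.
  (* The increment turns the run [q ^ rho l - 1] into [q ^ rho l]: a digit sum [(q - 1) * rho l]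
     becomes 1, and the carry stays inside the block because [rho l < h]. *)
  pose (a' := fun i => if i =? l then q ^ rho l else a i).
  assert (Ha' : forall i, i < K -> a' i < q ^ h).
  { intros i Hi. unfold a'. destruct (Nat.eqb_spec i l); [auto|].
    unfold a. specialize (Ha i Hi). lia. }
  destruct (digit_sum_blocks q h c a' K Hq2 Ha') as [B1 B2]. fold G in B1.
  assert (ET : T l = F l * q ^ G + q ^ (c + h * l)).
  { unfold F. rewrite <- (HT l Hl). rewrite (Nat.mul_comm (T l / _)). apply Nat.div_mod_eq. }
  assert (Eal : a' l = q ^ rho l) by (unfold a'; now rewrite Nat.eqb_refl).
  assert (EA : nsum (fun l => a l * q ^ (c + h * l)) K + q ^ (c + h * l)
               = nsum (fun l => a' l * q ^ (c + h * l)) K).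
  { pose proof (nsum_update (fun l => a l * q ^ (c + h * l)) (fun l => a' l * q ^ (c + h * l)) K l Hl) as U.
    cbv beta in U. rewrite Eal in U.
    assert (q ^ rho l * q ^ (c + h * l) = a l * q ^ (c + h * l) + q ^ (c + h * l)).
    { unfold a. specialize (Hpp l). nia. }
    rewrite <- (Nat.add_cancel_r _ _ (a l * q ^ (c + h * l))). rewrite <- U.
    - lia.
    - intros i _ Hi. unfold a'. apply Nat.eqb_neq in Hi. now rewrite Hi. }
  replace (top * q ^ (G + (M + 1)) + (nsum (fun l => a l * q ^ (c + h * l)) K + X * q ^ G) + T l)
    with ((top * q ^ (M + 1) + (X + F l)) * q ^ G + nsum (fun l => a' l * q ^ (c + h * l)) K).
  2:{ rewrite ET, <- EA, (Nat.pow_add_r q G). ring. }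
  pose proof (npow_pos q c Hq2).
  rewrite digit_sum_app by (auto; lia).
  rewrite digit_sum_app; [|auto|].
  2:{ rewrite Nat.add_1_r, Nat.pow_succ_r'. specialize (HF l Hl). fold (F l) in HF. nia. }
  rewrite B2. fold (e l).
  pose proof (nsum_update (fun l => digit_sum q (a' l)) (fun l => (q - 1) * rho l) K l Hl) as U.
  cbv beta in U. fold R in U. rewrite Eal, digit_sum_pow in U by auto.
  assert (U' : nsum (fun l => digit_sum q (a' l)) K + (q - 1) * rho l = R + 1).
  { apply U. intros i Hi Hn. unfold a'. apply Nat.eqb_neq in Hn. rewrite Hn.
    unfold a. now apply digit_sum_pow_pred. }
  destruct (Hrho l Hl) as [E _]. lia.
Qed.

Lemma mod_pow_trans q a c n m : 2 <= q -> c <= a -> n mod q ^ a = m -> m mod q ^ c = 0 -> n mod q ^ c = 0.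
Proof.
  intros Hq Hc E1 E2. pose proof (Nat.div_mod_eq n (q ^ a)) as D.
  rewrite E1 in D. replace a with (a - c + c) in D at 1 by lia. rewrite Nat.pow_add_r in D.
  rewrite D. rewrite Nat.Div0.add_mod, E2.
  replace (q ^ (a - c) * q ^ c * (n / q ^ a)) with (q ^ (a - c) * (n / q ^ a) * q ^ c) by ring.
  rewrite Nat.Div0.mod_mul. apply Nat.Div0.mod_0_l.
Qed.

Lemma pow_mod_pow q a c : 2 <= q -> c <= a -> q ^ a mod q ^ c = 0.
Proof.
  intros Hq Hc. replace a with (a - c + c) by lia. rewrite Nat.pow_add_r. apply Nat.Div0.mod_mul.
Qed.

Lemma digit_sum_add_low q c m r :
  2 <= q -> m mod q ^ c = 0 -> r < q ^ c -> digit_sum q (m + r) = digit_sum q m + digit_sum q r.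
Proof.
  intros Hq Hm Hr. pose proof (Nat.div_mod_eq m (q ^ c)) as D. rewrite Hm in D.
  rewrite Nat.add_0_r, Nat.mul_comm in D. rewrite D, digit_sum_app, digit_sum_mul_pow by auto. reflexivity.
Qed.

(* The ternary side is twice as long because the gadget only produces even ternary digit sums. *)
Definition box (c w : nat) : Prop :=
  exists A B, forall i j, i < w -> j < 2 * w ->
    exists r, r < 2 ^ c /\ digit_sum 2 r = A + i /\ digit_sum 3 r = B + j.

(* 400 = 20 * 20 translates of a w x 2w box, all multiples of 6 ^ c, tile a 20w x 40w box. *)
Lemma box_step c h w b :
  c = h * 400 -> 3 <= c -> 0 < w -> 3 * b + 2 * (40 * w) < h ->
  (9 * INR 400 * INR (2 * (c + h * 400) + 1) <= INR b ^ 2)%R ->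
  box c w -> box (20 * c) (20 * w).
Proof.
  intros Hch Hc Hw Hh Hb [A [B HAB]].
  set (K := 400) in *. assert (HK : 0 < K) by (unfold K; lia).
  set (G := c + h * K) in *. assert (HG : G = 2 * c) by (unfold G; lia).
  (* [T l] is below [6 ^ G], so its part above position [G] is below [3 ^ G] in base 2 and below
     [2 ^ G] in base 3; [2 * G] digits hold it in either base. *)
  set (M := 2 * G) in *.
  assert (HT : exists T : nat -> nat, forall l, l < K ->
    T l < 2 ^ G * 3 ^ G /\ T l mod 2 ^ G = 2 ^ (c + h * l) /\ T l mod 3 ^ G = 3 ^ (c + h * l)).
  { apply (finite_choice (fun l t => t < 2 ^ G * 3 ^ G /\ t mod 2 ^ G = 2 ^ (c + h * l) /\ t mod 3 ^ G = 3 ^ (c + h * l))).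
    intros l Hl.
    destruct (crt (2 ^ G) (3 ^ G) (2 ^ (c + h * l)) (3 ^ (c + h * l))) as [t [H1 [H2 H3]]].
    - apply rel_prime_2_3.
    - apply npow_pos; lia.
    - apply npow_pos; lia.
    - exists t. split; [auto|]. rewrite H2, H3.
      split; apply Nat.mod_small, Nat.pow_lt_mono_r; unfold G; nia. }
  destruct HT as [T HT].
  assert (H23 : forall n, 2 ^ n <= 3 ^ n) by (intros; apply Nat.pow_le_mono_l; lia).
  assert (H34 : forall n, 3 ^ n <= 2 ^ (2 * n)).
  { intros n. rewrite Nat.pow_mul_r. apply Nat.pow_le_mono_l. simpl; lia. }
  assert (Hodd : forall n, 3 ^ n mod 2 = 1).
  { induction n as [|n IH]; [reflexivity|]. rewrite Nat.pow_succ_r', Nat.Div0.mul_mod, IH. reflexivity. }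
  (* [T l] is even, while [3 ^ G] and the residue of [T l] modulo [3 ^ G] are odd; so every quotient
     is odd. This is the parity hypothesis of [gadget] in base 3. *)
  assert (HF : forall l, l < K -> (T l / 3 ^ G) mod 2 = 1).
  { intros l Hl. destruct (HT l Hl) as [_ [E2 E3]].
    assert (Ev : T l mod 2 ^ 1 = 0).
    { apply (mod_pow_trans 2 G 1 (T l) (2 ^ (c + h * l))); try lia. apply pow_mod_pow; lia. }
    pose proof (Nat.div_mod_eq (T l) (3 ^ G)) as D. rewrite E3 in D.
    rewrite D in Ev. change (2 ^ 1) with 2 in Ev.
    rewrite Nat.Div0.add_mod, Nat.Div0.mul_mod, !Hodd in Ev.
    pose proof (Nat.mod_upper_bound (T l / 3 ^ G) 2 ltac:(lia)).
    destruct ((T l / 3 ^ G) mod 2) as [|[|]]; [discriminate Ev|reflexivity|lia]. }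
  (* The index [l] is read in base 20: its upper digit moves the binary digit sum in steps of [w],
     its lower digit the ternary one in steps of [2 * w]. *)
  destruct (gadget 2 c h K M T (fun l => w * (l / 20)) b (40 * w)) as [N2 [N2c [N2b HN2]]]; auto.
  { intros l Hl. apply HT; auto. }
  { intros l Hl. apply Nat.Div0.div_lt_upper_bound. destruct (HT l Hl) as [H1 _].
    fold G. specialize (H34 G). fold M in H34. nia. }
  { intros l Hl. assert (l / 20 < 20) by (apply Nat.Div0.div_lt_upper_bound; unfold K in Hl; lia). nia. }
  destruct (gadget 3 c h K M T (fun l => 2 * w * (l mod 20)) b (40 * w)) as [N3 [N3c [N3b HN3]]]; auto.
  { intros l Hl. apply HT; auto. }
  { intros l Hl. apply Nat.Div0.div_lt_upper_bound. destruct (HT l Hl) as [H1 _].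
    fold G. assert (2 ^ G <= 3 ^ M) by (eapply Nat.le_trans; [apply H23|]; apply Nat.pow_le_mono_r; unfold M; lia).
    nia. }
  { intros; simpl (3 - 1). fold G. rewrite !HF; auto. }
  { intros l Hl. simpl (3 - 1). replace (2 * w * (l mod 20)) with (w * (l mod 20) * 2) by ring. apply Nat.Div0.mod_mul. }
  { intros l Hl. pose proof (Nat.mod_upper_bound l 20 ltac:(lia)). nia. }
  fold G in HN2, HN3, N2b, N3b.
  set (L := G + (M + 1)) in *.
  destruct (crt (2 ^ L) (3 ^ L) N2 N3) as [N [HN [E2 E3]]].
  { apply rel_prime_2_3. } { apply npow_pos; lia. } { apply npow_pos; lia. }
  rewrite (Nat.mod_small N2) in E2 by auto. rewrite (Nat.mod_small N3) in E3 by auto.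
  (* [N] is controlled only modulo [2 ^ L] and [3 ^ L]; whatever lies above in each base takes the
     place of [top]. *)
  destruct (HN2 (N / 2 ^ L)) as [C2 HC2]. destruct (HN3 (N / 3 ^ L)) as [C3 HC3].
  assert (D2 : N = N / 2 ^ L * 2 ^ L + N2) by (rewrite <- E2; rewrite Nat.mul_comm; apply Nat.div_mod_eq).
  assert (D3 : N = N / 3 ^ L * 3 ^ L + N3) by (rewrite <- E3; rewrite Nat.mul_comm; apply Nat.div_mod_eq).
  rewrite <- D2 in HC2. rewrite <- D3 in HC3.
  exists (A + C2), (B + C3). intros i j Hi Hj.
  destruct (HAB (i mod w) (j mod (2 * w))) as [r [Hr [R2 R3]]].
  { apply Nat.mod_upper_bound; lia. } { apply Nat.mod_upper_bound; lia. }
  assert (Hiw : i / w < 20) by (apply Nat.Div0.div_lt_upper_bound; lia).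
  assert (Hjw : j / (2 * w) < 20) by (apply Nat.Div0.div_lt_upper_bound; lia).
  set (l := i / w * 20 + j / (2 * w)).
  assert (Hl : l < K) by (unfold l, K; lia).
  assert (l1 : l / 20 = i / w) 
    by (unfold l; rewrite Nat.div_add_l, (Nat.div_small (j / (2 * w))) by lia; apply Nat.add_0_r).
  assert (l2 : l mod 20 = j / (2 * w)) 
    by (unfold l; rewrite Nat.add_comm, Nat.Div0.mod_add, Nat.mod_small by lia; reflexivity).
  destruct (HT l Hl) as [T1 [T2 T3]].
  exists (N + T l + r). split; [|split].
  (* Origin of the factor 20: here [L = 6 * c + 1], and the sum lies below 2^(3L+2), where 3L + 2 =
     18c + 5 <= 20c because [3 <= c]. *)
  - assert (6 ^ L <= 2 ^ (3 * L)) by (rewrite (Nat.pow_mul_r 2 3); apply Nat.pow_le_mono_l; simpl; lia).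
    assert (6 ^ G <= 2 ^ (3 * L)).
    { eapply Nat.le_trans; [|exact H]. apply Nat.pow_le_mono_r; unfold L; lia. }
    rewrite <- Nat.pow_mul_l in HN, T1. change (2 * 3) with 6 in *.
    assert (2 ^ c <= 2 ^ (3 * L)) by (apply Nat.pow_le_mono_r; unfold L; lia).
    apply Nat.lt_le_trans with (2 ^ (3 * L + 2)).
    + rewrite (Nat.pow_add_r 2 _ 2). change (2 ^ 2) with 4. lia.
    + apply Nat.pow_le_mono_r; unfold L, M; lia.
  - rewrite (digit_sum_add_low 2 c); [|lia| |auto].
    + rewrite HC2, R2, l1 by auto. pose proof (Nat.div_mod_eq i w) as Di.
      set (u := i / w) in *. set (v := i mod w) in *. clearbody u v. lia.
    + rewrite Nat.Div0.add_mod.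
      rewrite (mod_pow_trans 2 L c N N2) by (auto; unfold L, G; lia).
      rewrite (mod_pow_trans 2 G c (T l) (2 ^ (c + h * l))) by (auto; try apply pow_mod_pow; unfold G; lia).
      apply Nat.Div0.mod_0_l.
  - rewrite (digit_sum_add_low 3 c); [|lia| |specialize (H23 c); lia].
    + rewrite HC3, R3, l2 by auto. pose proof (Nat.div_mod_eq j (2 * w)) as Dj.
      set (u := j / (2 * w)) in *. set (v := j mod (2 * w)) in *. clearbody u v. lia.
    + rewrite Nat.Div0.add_mod.
      rewrite (mod_pow_trans 3 L c N N3) by (auto; unfold L, G; lia).
      rewrite (mod_pow_trans 3 G c (T l) (3 ^ (c + h * l))) by (auto; try apply pow_mod_pow; unfold G; lia).
      apply Nat.Div0.mod_0_l.
Qed.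

(** The noise is of order sqrt c while the room for it is proportional to c, so one large [b0]
    serves all scales: with W = [w * b0] the requirement is 3600 (6400 W + 1) <= W^2. The initial
    box consists of r = 1 and r = 2. *)
Lemma box_all : exists c0, 0 < c0 /\ forall s, box (20 ^ s * c0) (20 ^ s).
Proof.
  destruct (nat_above 30000000) as [b0 Hb0].
  assert (Hb1 : 81 <= b0).
  { apply INR_le. eapply Rle_trans; [|exact Hb0]. rewrite INR_IZR_INZ. apply IZR_le. lia. }
  exists (400 * (4 * b0)). split; [lia|]. induction s as [|s IH].
  - exists 1, 1. intros i j Hi Hj. exists (1 + j). cbn [Nat.pow] in *.
    assert (2 ^ 2 <= 2 ^ (1 * (400 * (4 * b0)))) by (apply Nat.pow_le_mono_r; lia).
    change (2 ^ 2) with 4 in *.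
    split; [lia|]. destruct i as [|]; [|lia]. destruct j as [|[|]]; [split; reflexivity..|lia].
  - rewrite Nat.pow_succ_r'.
    pose proof (npow_pos 20 s ltac:(lia)) as Hp. set (w := 20 ^ s) in *. clearbody w.
    rewrite <- Nat.mul_assoc. apply (box_step _ (w * (4 * b0)) _ (w * b0)); auto; [lia|nia|nia|].
    assert (Hw : (1 <= INR w)%R) by (change 1%R with (INR 1); apply le_INR; lia).
    rewrite !plus_INR, !mult_INR, plus_INR, !mult_INR.
    repeat match goal with |- context [INR ?n] =>
      match n with w => fail 1 | b0 => fail 1 | _ => rewrite (INR_IZR_INZ n) end end.
    simpl Z.of_nat.
    assert (HW : (30000000 <= INR w * INR b0)%R) by nra.
    replace (9 * 400 * (2 * (INR w * (400 * (4 * INR b0)) + INR w * (4 * INR b0) * 400) + 1))%R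
      with (3600 * (6400 * (INR w * INR b0) + 1))%R by ring.
    generalize dependent (INR w * INR b0)%R. intros W HW. nra.
Qed.
Close Scope nat_scope.

(** * Typical digit sums along multiples of 6 ^ c *)

Lemma dev_app q m p n : (2 <= q)%nat ->
  dev q (m + p) n = dev q m (n mod q ^ m) + dev q p (n / q ^ m).
Proof.
  intros Hq. unfold dev.
  assert (E : digit_sum q n = (digit_sum q (n / q ^ m) + digit_sum q (n mod q ^ m))%nat).
  { rewrite <- digit_sum_app with (c := m); auto.
    - f_equal. rewrite Nat.mul_comm. apply Nat.div_mod_eq.
    - apply Nat.mod_upper_bound. pose proof (npow_pos q m Hq). lia. }
  rewrite E, !plus_INR. lra.
Qed.

(** Cut the digits at position [m]. As [g] is invertible modulo [q ^ m], a low part recurs only with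
    period [q ^ m]; a high part persists for at most [q ^ m / g + 1] consecutive [t]. So
    multiplicities exceed the uniform ones by factors at most 2 and [2 * C], where [C] bounds the
    ratio of the full digit range to the length of the progression, and the variance bound carries
    over. *)
Lemma ap_cheb q b g T m p C :
  (q = 2 \/ q = 3)%nat -> (0 < g <= q ^ m)%nat -> (q ^ m <= T)%nat -> (1 <= C)%nat ->
  (forall d, Nat.divide (q ^ m) (g * d) -> Nat.divide (q ^ m) d) ->
  (b + g * T <= q ^ (m + p))%nat -> (q ^ (m + p) <= C * (g * T))%nat ->
  rsum (fun t => (dev q (m + p) (b + g * t)) ^ 2) T <= INR T * (12 * INR C * INR (m + p)).
Proof.
  intros Hq Hg HT HC Hcop Hup Hlow.
  assert (Hq2 : (2 <= q)%nat) by lia.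
  pose proof (npow_pos q m Hq2) as Hm. pose proof (npow_pos q p Hq2) as Hp.
  set (Q := (q ^ m)%nat) in *.
  assert (H1 : rsum (fun t => (dev q m ((b + g * t) mod Q)) ^ 2) T <= INR (T / Q + 1) * (INR Q * (3 * INR m))).
  { eapply Rle_trans.
    - apply (rsum_fibres (fun t => (b + g * t) mod Q)%nat (fun r => dev q m r ^ 2) T Q (INR (T / Q + 1))).
      + intros; apply pow2_ge_0.
      + intros; apply Nat.mod_upper_bound; lia.
      + intros h _. apply (count_spaced (fun t => ((b + g * t) mod Q =? h)%nat) Q); [lia| |].
        * pose proof (Nat.div_mod_eq T Q). pose proof (Nat.mod_upper_bound T Q ltac:(lia)). nia.
        * intros i j Hij Hi Hj. apply Nat.eqb_eq in Hi, Hj.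
          assert (D : Nat.divide Q (g * (j - i))).
          { exists ((b + g * j) / Q - (b + g * i) / Q)%nat.
            pose proof (Nat.div_mod_eq (b + g * j) Q). pose proof (Nat.div_mod_eq (b + g * i) Q).
            rewrite Nat.mul_sub_distr_l, Nat.mul_sub_distr_r. nia. }
          apply Hcop, Nat.divide_pos_le in D; lia.
    - apply Rmult_le_compat_l; [apply pos_INR|]. now apply rsum_dev_sq. }
  assert (H2 : rsum (fun t => (dev q p ((b + g * t) / Q)) ^ 2) T <= INR (Q / g + 1) * (INR (q ^ p) * (3 * INR p))).
  { eapply Rle_trans.
    - apply (rsum_fibres (fun t => (b + g * t) / Q)%nat (fun r => dev q p r ^ 2) T (q ^ p) (INR (Q / g + 1))).
      + intros; apply pow2_ge_0.
      + intros t Ht. apply Nat.Div0.div_lt_upper_bound. rewrite Nat.pow_add_r in Hup. fold Q in Hup. nia.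
      + intros h _. apply (count_close (fun t => ((b + g * t) / Q =? h)%nat)).
        intros i j Hij Hi Hj. apply Nat.eqb_eq in Hi, Hj.
        pose proof (Nat.div_mod_eq (b + g * j) Q). pose proof (Nat.div_mod_eq (b + g * i) Q).
        pose proof (Nat.mod_upper_bound (b + g * j) Q ltac:(lia)).
        rewrite Hi in *. rewrite Hj in *.
        assert (g * (j - i) < Q)%nat by nia.
        assert (j - i <= Q / g)%nat by (apply Nat.div_le_lower_bound; lia). lia.
    - apply Rmult_le_compat_l; [apply pos_INR|]. now apply rsum_dev_sq. }
  apply Rle_trans with (rsum (fun t => 2 * (dev q m ((b + g * t) mod Q)) ^ 2 + 2 * (dev q p ((b + g * t) / Q)) ^ 2) T).
  { apply rsum_le. intros t _. rewrite dev_app by auto. fold Q.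
    generalize (dev q m ((b + g * t) mod Q)) (dev q p ((b + g * t) / Q)). intros x y.
    pose proof (pow2_ge_0 (x - y)). nra. }
  rewrite rsum_plus, !rsum_scal, plus_INR.
  assert (B1 : INR (T / Q + 1) * INR Q <= 2 * INR T).
  { rewrite <- mult_INR. change 2 with (INR 2). rewrite <- mult_INR. apply le_INR.
    pose proof (Nat.Div0.mul_div_le T Q). nia. }
  assert (B2 : INR (Q / g + 1) * INR (q ^ p) <= 2 * (INR C * INR T)).
  { rewrite <- !mult_INR. change 2 with (INR 2). rewrite <- mult_INR. apply le_INR.
    pose proof (Nat.Div0.mul_div_le Q g) as D. rewrite Nat.pow_add_r in Hlow. fold Q in Hlow.
    apply (Nat.mul_le_mono_pos_l _ _ g); [lia|].
    assert (g * (Q / g + 1) <= 2 * Q)%nat by lia.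
    assert (g * (Q / g + 1) * q ^ p <= 2 * Q * q ^ p)%nat by (apply Nat.mul_le_mono_r; auto). nia. }
  assert (1 <= INR C) by (change 1 with (INR 1); apply le_INR; auto).
  pose proof (pos_INR m). pose proof (pos_INR p). pose proof (pos_INR T).
  assert (INR (T / Q + 1) * (INR Q * (3 * INR m)) <= 6 * INR T * INR m).
  { rewrite <- Rmult_assoc. apply Rle_trans with (2 * INR T * (3 * INR m)); [apply Rmult_le_compat_r; lra|lra]. }
  assert (INR (Q / g + 1) * (INR (q ^ p) * (3 * INR p)) <= 6 * (INR C * INR T) * INR p).
  { rewrite <- Rmult_assoc. apply Rle_trans with (2 * (INR C * INR T) * (3 * INR p)); [apply Rmult_le_compat_r; lra|lra]. }
  assert (INR T * INR m <= INR C * INR T * INR m).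
  { rewrite <- (Rmult_1_l (INR T * INR m)), Rmult_assoc. apply Rmult_le_compat_r; auto. now apply Rmult_le_pos. }
  lra.
Qed.

Local Open Scope nat_scope.

Definition pair23 (q1 q2 : nat) : Prop := (q1 = 2 /\ q2 = 3) \/ (q1 = 3 /\ q2 = 2).

Lemma pair23_divide q1 q2 a b d : pair23 q1 q2 -> Nat.divide (q1 ^ a) (q2 ^ b * d) -> Nat.divide (q1 ^ a) d.
Proof.
  intros Hq [k Hk].
  assert (Hr : rel_prime (Z.of_nat (q1 ^ a)) (Z.of_nat (q2 ^ b))).
  { destruct Hq as [[-> ->]|[-> ->]]; [|apply rel_prime_sym]; apply rel_prime_2_3. }
  assert (D : (Z.of_nat (q1 ^ a) | Z.of_nat d)%Z).
  { apply (Gauss _ (Z.of_nat (q2 ^ b))); auto. exists (Z.of_nat k). lia. }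
  destruct D as [z Hz]. exists (Z.to_nat z).
  assert (2 <= q1) by (destruct Hq; lia). pose proof (npow_pos q1 a ltac:(lia)). nia.
Qed.

Lemma pair23_sq q1 q2 c : pair23 q1 q2 -> q2 ^ c <= q1 ^ (2 * c).
Proof.
  intros Hq. rewrite Nat.pow_mul_r. apply Nat.pow_le_mono_l.
  destruct Hq as [[-> ->]|[-> ->]]; simpl; lia.
Qed.

Lemma pair23_sym q1 q2 : pair23 q1 q2 -> pair23 q2 q1.
Proof. unfold pair23; lia. Qed.

(* M = n' + z0 + 6 ^ c * t with n' = n or n + q1 ^ (8 c), chosen so that no carry reaches
   position u + 1 in base q2, and t typical for both bases. *)
Lemma dense_correction q1 q2 c u n :
  pair23 q1 q2 -> 2 <= c -> 1 <= u -> q1 ^ (8 * c) <= q2 ^ u -> q2 ^ (u - 1) < q1 ^ (8 * c) ->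
  n mod q1 ^ (8 * c + 1) = 0 ->
  exists M s1 s2, M mod 2 ^ c = 0 /\ M mod 3 ^ c = 0 /\
    digit_sum q1 M = digit_sum q1 n + s1 /\
    digit_sum q2 M = digit_sum q2 ((n + q1 ^ (8 * c)) / q2 ^ (u + 1)) + s2 /\
    ((2 * INR s1 - INR (q1 - 1) * INR (7 * c)) ^ 2 <= 10000 * INR c)%R /\
    ((2 * INR s2 - INR (q2 - 1) * INR (u + 1 - c)) ^ 2 <= 10000 * INR c)%R.
Proof.
  intros Hp Hc Hu HuL HuU Hn.
  assert (Hq1 : q1 = 2 \/ q1 = 3) by (destruct Hp; lia).
  assert (Hq2 : q2 = 2 \/ q2 = 3) by (destruct Hp; lia).
  assert (Hq1' : 2 <= q1) by lia. assert (Hq2' : 2 <= q2) by lia.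
  set (E := 8 * c) in *.
  assert (HE : q1 ^ (E + 1) = q1 ^ E * q1) by (rewrite Nat.add_1_r, Nat.pow_succ_r'; ring).
  assert (Hu1 : q2 ^ (u + 1) = q2 ^ u * q2) by (rewrite Nat.add_1_r, Nat.pow_succ_r'; ring).
  assert (Hu2 : q2 ^ u = q2 ^ (u - 1) * q2) by (replace u with (S (u - 1)) at 1 by lia; rewrite Nat.pow_succ_r'; ring).
  pose proof (npow_pos q1 E Hq1') as HEp.
  pose proof (npow_pos q2 (u + 1) Hq2') as Hup.
  set (V := (n + q1 ^ E) / q2 ^ (u + 1)).
  (* Let y be the residue of [n + q1 ^ E] modulo [q2 ^ (u + 1)]. If [q1 ^ E] more still fits below
     [q2 ^ (u + 1)], take [n + q1 ^ E]; otherwise y >= [q1 ^ E], since [q2 ^ (u + 1)] is at least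
     [2 * q1 ^ E], and stepping back to [n] keeps the same quotient [V]. *)
  assert (Hn' : exists n' e, n' mod q1 ^ E = 0 /\ digit_sum q1 n' = digit_sum q1 n + e /\ e <= 1 /\
     V * q2 ^ (u + 1) <= n' /\ n' + q1 ^ E <= (V + 1) * q2 ^ (u + 1)).
  { pose proof (Nat.div_mod_eq (n + q1 ^ E) (q2 ^ (u + 1))) as D. fold V in D.
    pose proof (Nat.mod_upper_bound (n + q1 ^ E) (q2 ^ (u + 1)) ltac:(lia)) as Hy.
    set (y := (n + q1 ^ E) mod q2 ^ (u + 1)) in *.
    assert (Hn0 : n mod q1 ^ E = 0) by (apply (mod_pow_trans q1 (E + 1) E n 0); auto; [lia|apply Nat.Div0.mod_0_l]).
    destruct (Nat.le_gt_cases (y + q1 ^ E) (q2 ^ (u + 1))) as [Hle|Hgt].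
    - exists (n + q1 ^ E), 1. repeat split; try lia.
      + rewrite Nat.Div0.add_mod, Hn0, Nat.Div0.mod_same. apply Nat.Div0.mod_0_l.
      + rewrite (digit_sum_add_low q1 (E + 1)) by (auto; nia). rewrite digit_sum_pow; auto.
    - exists n, 0. repeat split; try lia; nia. }
  destruct Hn' as [n' [e [Hn'0 [Hn's [He [HV1 HV2]]]]]].
  set (y := n' - V * q2 ^ (u + 1)).
  set (Q := 6 ^ c).
  assert (HQ : Q = q1 ^ c * q2 ^ c).
  { unfold Q. rewrite <- Nat.pow_mul_l. destruct Hp as [[-> ->]|[-> ->]]; reflexivity. }
  assert (HQp : 0 < Q) by (unfold Q; apply npow_pos; lia).
  pose proof (npow_pos q1 c Hq1') as H1p. pose proof (npow_pos q2 c Hq2') as H2p.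
  pose proof (pair23_sq q1 q2 c Hp) as Hsq1.
  pose proof (pair23_sq q2 q1 c (pair23_sym _ _ Hp)) as Hsq2.
  assert (HQ3 : Q <= q1 ^ (3 * c)).
  { rewrite HQ. replace (3 * c) with (c + 2 * c) by lia. rewrite Nat.pow_add_r. nia. }
  (* Reason for the 8 in [8 * c]: [Q] takes up to [3 * c] digits, a range of [t] beyond
     [q2 ^ (2 * c)] up to [4 * c], and the last [c] is slack. *)
  assert (HT0 : exists T, q1 ^ (2 * c) <= T /\ q2 ^ (2 * c) <= T /\ Q * (T + 1) <= q1 ^ E /\ q1 ^ E <= 2 * (Q * T) /\ 0 < T).
  { exists (q1 ^ E / Q - 1).
    assert (q1 ^ (4 * c) + 3 <= q1 ^ E / Q).
    { apply Nat.div_le_lower_bound; [lia|].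
      apply Nat.le_trans with (q1 ^ (3 * c) * (q1 ^ (5 * c))).
      - apply Nat.mul_le_mono; auto.
        replace (5 * c) with (4 * c + c) by lia. rewrite Nat.pow_add_r.
        assert (A1 : q1 ^ 2 <= q1 ^ c) by (apply Nat.pow_le_mono_r; lia).
        assert (A2 : q1 ^ 1 <= q1 ^ (4 * c)) by (apply Nat.pow_le_mono_r; lia).
        rewrite Nat.pow_1_r in A2. rewrite Nat.pow_2_r in A1.
        assert (A3 : 4 <= q1 ^ c) by (clear -A1 Hq1'; nia).
        set (A := q1 ^ (4 * c)) in *. set (B := q1 ^ c) in *. clear -A2 A3 Hq1'. nia.
      - rewrite <- Nat.pow_add_r. apply Nat.pow_le_mono_r; unfold E; lia. }
    assert (q1 ^ (2 * c) <= q1 ^ (4 * c)) by (apply Nat.pow_le_mono_r; lia).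
    assert (q2 ^ (2 * c) <= q1 ^ (4 * c)).
    { replace (4 * c) with (2 * (2 * c)) by lia. apply pair23_sq; auto. }
    pose proof (Nat.div_mod_eq (q1 ^ E) Q). pose proof (Nat.mod_upper_bound (q1 ^ E) Q ltac:(lia)).
    set (t := q1 ^ E / Q) in *.
    repeat split; try lia; nia. }
  destruct HT0 as [T [HT1 [HT2 [HT3 [HT4 HTp]]]]].
  set (z0 := (Q - n' mod Q) mod Q).
  assert (Hz0 : z0 < Q) by (apply Nat.mod_upper_bound; lia).
  assert (Hdiv : (n' + z0) mod Q = 0).
  { unfold z0. rewrite Nat.Div0.add_mod_idemp_r.
    pose proof (Nat.div_mod_eq n' Q). pose proof (Nat.mod_upper_bound n' Q ltac:(lia)).
    replace (n' + (Q - n' mod Q)) with ((n' / Q + 1) * Q) by nia. apply Nat.Div0.mod_mul. }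
  apply Nat.Lcm0.mod_divide in Hdiv. destruct Hdiv as [kQ HkQ].
  (* In base [q1] the part below [n'] is divisible by [q1 ^ c]; in base [q2] the part below [V] is
     [y] plus the correction, divisible by [q2 ^ c]. After division both run through progressions
     whose step is prime to the base. *)
  assert (Hz1 : exists b1, z0 = q1 ^ c * b1).
  { apply (mod_pow_trans q1 E c n' 0 Hq1' ltac:(unfold E; lia)) in Hn'0; [|apply Nat.Div0.mod_0_l].
    apply Nat.Lcm0.mod_divide in Hn'0. destruct Hn'0 as [a Ha].
    exists (kQ * q2 ^ c - a). rewrite HQ in HkQ. rewrite Nat.mul_sub_distr_l. nia. }
  destruct Hz1 as [b1 Hb1].
  assert (Huc : 3 * c <= u + 1).
  { destruct (Nat.le_gt_cases (3 * c) (u + 1)) as [|Hlt]; auto. exfalso.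
    assert (q2 ^ u < q2 ^ (4 * c)) by (apply Nat.pow_lt_mono_r; lia).
    assert (q2 ^ (4 * c) <= q1 ^ E).
    { replace E with (2 * (4 * c)) by (unfold E; lia). now apply pair23_sq. } lia. }
  assert (Hz2 : exists b2, y + z0 = q2 ^ c * b2).
  { exists (kQ * q1 ^ c - V * q2 ^ (u + 1 - c)).
    assert (q2 ^ (u + 1) = q2 ^ c * q2 ^ (u + 1 - c)) by (rewrite <- Nat.pow_add_r; f_equal; lia).
    rewrite Nat.mul_sub_distr_l. unfold y. nia. }
  destruct Hz2 as [b2 Hb2].
  (* The 2 comes from [q1 ^ E <= 2 * (Q * T)]; the 18 from [q2 ^ (u + 1)], which is [q2 ^ 2] times
     [q2 ^ (u - 1)], hence at most 9 times [q1 ^ E]. *)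
  assert (C1 := ap_cheb q1 b1 (q2 ^ c) T (2 * c) (5 * c) 2 Hq1).
  assert (C2 := ap_cheb q2 b2 (q1 ^ c) T (2 * c) (u + 1 - 3 * c) 18 Hq2).
  replace (2 * c + 5 * c) with (7 * c) in C1 by lia.
  replace (2 * c + (u + 1 - 3 * c)) with (u + 1 - c) in C2 by lia.
  assert (HE7 : q1 ^ E = q1 ^ c * q1 ^ (7 * c)) by (rewrite <- Nat.pow_add_r; f_equal; unfold E; lia).
  assert (Huc' : q2 ^ (u + 1) = q2 ^ c * q2 ^ (u + 1 - c)) by (rewrite <- Nat.pow_add_r; f_equal; lia).
  assert (R1 : (rsum (fun t => dev q1 (7 * c) (b1 + q2 ^ c * t) ^ 2) T <= INR T * (12 * INR 2 * INR (7 * c)))%R).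
  { apply C1; auto; try lia.
    - intros d. now apply pair23_divide.
    - apply (Nat.mul_le_mono_pos_l _ _ (q1 ^ c)); [auto|]. rewrite HQ in HT3, Hz0. nia.
    - apply (Nat.mul_le_mono_pos_l _ _ (q1 ^ c)); [auto|]. rewrite HQ in HT4. nia. }
  assert (Hy : y + q1 ^ E <= q2 ^ (u + 1)) by (unfold y; nia).
  assert (R2 : (rsum (fun t => dev q2 (u + 1 - c) (b2 + q1 ^ c * t) ^ 2) T <= INR T * (12 * INR 18 * INR (u + 1 - c)))%R).
  { apply C2; auto; try lia.
    - intros d. apply pair23_divide. now apply pair23_sym.
    - apply (Nat.mul_le_mono_pos_l _ _ (q2 ^ c)); [auto|]. rewrite HQ in HT3, Hz0. nia.
    - apply (Nat.mul_le_mono_pos_l _ _ (q2 ^ c)); [auto|]. rewrite HQ in HT4.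
      assert (q2 * q2 <= 9) by (destruct Hq2 as [-> | ->]; lia). nia. }
  destruct (rsum_exists_le (fun t => dev q1 (7 * c) (b1 + q2 ^ c * t) ^ 2 + dev q2 (u + 1 - c) (b2 + q1 ^ c * t) ^ 2)%R T
     (12 * INR 2 * INR (7 * c) + 12 * INR 18 * INR (u + 1 - c))) as [t [Ht HtS]]; [auto| |].
  { rewrite rsum_plus. lra. }
  assert (Hu17 : u + 1 - c <= 17 * c).
  { destruct (Nat.le_gt_cases (u + 1) (18 * c)) as [|Hlt]; [lia|]. exfalso.
    assert (q2 ^ (16 * c) <= q2 ^ (u - 1)) by (apply Nat.pow_le_mono_r; lia).
    assert (q1 ^ E <= q2 ^ (2 * E)) by (apply pair23_sq; now apply pair23_sym).
    replace (2 * E) with (16 * c) in H0 by (unfold E; lia). lia. }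
  (* 24 * 7 + 216 * 17 = 3840. The room between 4000 and 10000 absorbs the possible extra digit [e],
     through (x + 2e)^2 <= 2x^2 + 8e^2. *)
  assert (HB : (12 * INR 2 * INR (7 * c) + 12 * INR 18 * INR (u + 1 - c) <= 4000 * INR c)%R).
  { apply le_INR in Hu17. rewrite mult_INR in *. rewrite !INR_IZR_INZ in *. simpl Z.of_nat in *.
    pose proof (pos_INR c). rewrite INR_IZR_INZ in H. lra. }
  pose proof (pow2_ge_0 (dev q1 (7 * c) (b1 + q2 ^ c * t))) as P1.
  pose proof (pow2_ge_0 (dev q2 (u + 1 - c) (b2 + q1 ^ c * t))) as P2.
  assert (Hzt : z0 + Q * t < q1 ^ E) by nia.
  exists (n' + (z0 + Q * t)), (e + digit_sum q1 (b1 + q2 ^ c * t)), (digit_sum q2 (b2 + q1 ^ c * t)).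
  assert (HM : n' + (z0 + Q * t) = (kQ + t) * Q) by nia.
  assert (H6 : Q = 2 ^ c * 3 ^ c) by (unfold Q; rewrite <- Nat.pow_mul_l; reflexivity).
  repeat split.
  - rewrite HM, H6. replace ((kQ + t) * (2 ^ c * 3 ^ c)) with ((kQ + t) * 3 ^ c * 2 ^ c) by ring. apply Nat.Div0.mod_mul.
  - rewrite HM, H6. replace ((kQ + t) * (2 ^ c * 3 ^ c)) with ((kQ + t) * 2 ^ c * 3 ^ c) by ring. apply Nat.Div0.mod_mul.
  - rewrite (digit_sum_add_low q1 E) by auto.
    replace (z0 + Q * t) with ((b1 + q2 ^ c * t) * q1 ^ c) by (rewrite HQ, Hb1; ring).
    rewrite digit_sum_mul_pow by auto. lia.
  - replace (n' + (z0 + Q * t)) with (V * q2 ^ (u + 1) + (y + z0 + Q * t)) by (unfold y; lia).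
    rewrite digit_sum_app by (auto; lia). fold V.
    replace (y + z0 + Q * t) with ((b2 + q1 ^ c * t) * q2 ^ c) by (rewrite Hb2, HQ; ring).
    rewrite digit_sum_mul_pow by auto. reflexivity.
  - unfold dev in P1, P2, HtS. rewrite plus_INR.
    assert (He' : (0 <= INR e <= 1)%R).
    { split; [apply pos_INR|]. change 1%R with (INR 1). now apply le_INR. }
    assert (Hc1 : (1 <= INR c)%R) by (change 1%R with (INR 1); apply le_INR; lia).
    set (x := (2 * INR (digit_sum q1 (b1 + q2 ^ c * t)) - INR (q1 - 1) * INR (7 * c))%R) in *.
    replace (2 * (INR e + INR (digit_sum q1 (b1 + q2 ^ c * t))) - INR (q1 - 1) * INR (7 * c))%R
      with (x + 2 * INR e)%R by (unfold x; ring).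
    assert (x ^ 2 <= 4000 * INR c)%R by lra.
    assert (0 <= (x - 2 * INR e) ^ 2)%R by apply pow2_ge_0. nra.
  - unfold dev in P1, P2, HtS. pose proof (pos_INR c). lra.
Qed.
Close Scope nat_scope.

(** * Sawtooth sums and irrational rotations *)

Lemma Rabs_le_elim x a : Rabs x <= a -> - a <= x <= a.
Proof. unfold Rabs. destruct (Rcase_abs x); lra. Qed.

Lemma frac_part_eq x k : 0 <= x - IZR k < 1 -> frac_part x = x - IZR k.
Proof.
  intros H. unfold frac_part, Int_part.
  rewrite <- (tech_up x (k + 1)); [f_equal; f_equal; lia| |]; rewrite plus_IZR; lra.
Qed.

Lemma frac_part_bounds x : 0 <= frac_part x < 1.
Proof. destruct (base_fp x); lra. Qed.

Lemma frac_part_int x : exists k, x = IZR k + frac_part x.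
Proof. exists (Int_part x). unfold frac_part. lra. Qed.

Lemma frac_part_shift x k : frac_part (x + IZR k) = frac_part x.
Proof.
  destruct (frac_part_int x) as [j E]. pose proof (frac_part_bounds x).
  rewrite (frac_part_eq _ (j + k)); rewrite plus_IZR; lra.
Qed.

Lemma floor_nat x : 0 <= x -> exists n : nat, INR n <= x < INR n + 1.
Proof.
  intros Hx. destruct (frac_part_int x) as [k E]. pose proof (frac_part_bounds x).
  assert (-1 < IZR k) by lra. apply lt_IZR in H0.
  exists (Z.to_nat k). rewrite INR_IZR_INZ, Z2Nat.id by lia. lra.
Qed.

Lemma dirichlet x (N : nat) : (1 <= N)%nat ->
  exists (q : nat) (a : Z), (1 <= q <= N)%nat /\ Rabs (INR q * x - IZR a) < 1 / INR N.
Proof.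
  intros HN. assert (0 < INR N) by (apply lt_0_INR; lia).
  pose (P := fun i r => INR r <= INR N * frac_part (INR i * x) < INR r + 1).
  destruct (finite_choice P (S N)) as [h Hh].
  { intros i _. apply floor_nat. pose proof (frac_part_bounds (INR i * x)). nra. }
  destruct (pigeonhole_nat h N) as [i [j [Hij E]]].
  { intros i Hi. destruct (Hh i ltac:(lia)) as [H1 _].
    pose proof (frac_part_bounds (INR i * x)). apply INR_lt. nra. }
  destruct (Hh i ltac:(lia)) as [Hi1 Hi2]. destruct (Hh j ltac:(lia)) as [Hj1 Hj2].
  destruct (frac_part_int (INR i * x)) as [ki Ei]. destruct (frac_part_int (INR j * x)) as [kj Ej].
  exists (j - i)%nat, (kj - ki)%Z. split; [lia|].
  rewrite minus_INR, minus_IZR by lia. rewrite E in *.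
  set (fi := frac_part (INR i * x)) in *. set (fj := frac_part (INR j * x)) in *.
  replace ((INR j - INR i) * x - (IZR kj - IZR ki)) with (fj - fi) by lra.
  assert (HH : - 1 < INR N * (fj - fi) < 1) by lra.
  apply Rabs_def1; apply (Rmult_lt_reg_l (INR N)); auto; field_simplify; lra.
Qed.

Lemma rsum_INR n : rsum INR n = INR n * (INR n - 1) / 2.
Proof. induction n as [|n IH]; [simpl; lra|]. cbn [rsum]. rewrite IH, S_INR. lra. Qed.

Lemma least_nat (P : nat -> Prop) n : P n -> exists m, P m /\ forall k, (k < m)%nat -> ~ P k.
Proof.
  induction n as [n IH] using (well_founded_induction Nat.lt_wf_0). intros Hn.
  destruct (Classical_Prop.classic (exists k, (k < n)%nat /\ P k)) as [[k [Hk Pk]]|H].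
  - eauto.
  - exists n; split; auto. intros k Hk Pk. apply H; eauto.
Qed.

Definition saw (x : R) : R := frac_part x - 1 / 2.

Lemma saw_bound x : Rabs (saw x) <= 1 / 2.
Proof. unfold saw. pose proof (frac_part_bounds x). apply Rabs_le; lra. Qed.

(* Up to an error 2 / q the points y + u x, u < q, are a permutation of the multiples of 1 / q;
   only the at most three points next to the jump of saw can contribute more. *)
Lemma saw_period x y (N q : nat) (a : Z) :
  (1 <= q <= N)%nat -> Rabs (INR q * x - IZR a) < 1 / INR N ->
  (forall (d : nat) (b : Z), (1 <= d < q)%nat -> 1 / INR N <= Rabs (INR d * x - IZR b)) ->
  Rabs (rsum (fun u => saw (y + INR u * x)) q) <= 6.
Proof.
  intros Hq Ha Hmin.
  assert (Hq0 : 0 < INR q) by (apply lt_0_INR; lia).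
  assert (HN0 : 0 < INR N) by (apply lt_0_INR; lia).
  assert (HqN : INR q <= INR N) by (apply le_INR; lia).
  set (e := INR q * x - IZR a) in *.
  destruct (frac_part_int (INR q * y)) as [k Ek]. pose proof (frac_part_bounds (INR q * y)) as Hf.
  set (f := frac_part (INR q * y)) in *.
  pose (w := fun u => Z.to_nat ((k + Z.of_nat u * a) mod Z.of_nat q)).
  assert (Hw : forall u, (w u < q)%nat).
  { intros u. unfold w. pose proof (Z.mod_pos_bound (k + Z.of_nat u * a) (Z.of_nat q) ltac:(lia)). lia. }
  (* Equal residues would put [(j - i) x] within (j - i) |e| / q < 1 / N of an integer, against the
     minimality of [q]. *)
  assert (Hwinj : forall i j, (i < j < q)%nat -> w i <> w j).
  { intros i j Hij E. unfold w in E.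
    pose proof (Z.mod_pos_bound (k + Z.of_nat i * a) (Z.of_nat q) ltac:(lia)).
    pose proof (Z.mod_pos_bound (k + Z.of_nat j * a) (Z.of_nat q) ltac:(lia)).
    pose proof (Z.div_mod (k + Z.of_nat i * a) (Z.of_nat q) ltac:(lia)) as Di.
    pose proof (Z.div_mod (k + Z.of_nat j * a) (Z.of_nat q) ltac:(lia)) as Dj.
    set (ti := ((k + Z.of_nat i * a) / Z.of_nat q)%Z) in *.
    set (tj := ((k + Z.of_nat j * a) / Z.of_nat q)%Z) in *.
    assert (E' : (Z.of_nat (j - i) * a = Z.of_nat q * (tj - ti))%Z) by (rewrite Nat2Z.inj_sub by lia; lia).
    specialize (Hmin (j - i)%nat (tj - ti)%Z ltac:(lia)).
    apply (f_equal IZR) in E'. rewrite !mult_IZR, <- !INR_IZR_INZ in E'.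
    assert (Hd : 0 < INR (j - i)) by (apply lt_0_INR; lia).
    assert (Hd' : INR (j - i) < INR q) by (apply lt_INR; lia).
    assert (E2 : INR q * (INR (j - i) * x - IZR (tj - ti)) = INR (j - i) * e) by (unfold e; nra).
    apply (f_equal Rabs) in E2. rewrite !Rabs_mult, (Rabs_pos_eq (INR q)), (Rabs_pos_eq (INR (j - i))) in E2 by lra.
    pose proof (Rabs_pos e). nra. }
  assert (Hpt : forall u, (u < q)%nat ->
    Rabs (frac_part (y + INR u * x) - INR (w u) / INR q)
      <= 2 / INR q + (indic (w u =? 0)%nat + indic (q - 2 <=? w u)%nat)).
  { intros u Hu.
    assert (Hfr := frac_part_bounds (y + INR u * x)).
    assert (Hwq : 0 <= INR (w u) / INR q <= 1).
    { split; [apply Rmult_le_pos; [apply pos_INR|left; now apply Rinv_0_lt_compat]|].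
      apply (Rmult_le_reg_r (INR q)); auto. field_simplify; [|lra].
      left; apply lt_INR, Hw. }
    assert (H2q : 0 < 2 / INR q) by (apply Rdiv_lt_0_compat; lra).
    destruct (Nat.eqb_spec (w u) 0) as [E0|E0]; cbn [indic];
      [pose proof (indic_nonneg (q - 2 <=? w u)%nat); apply Rabs_le; lra|].
    destruct (Nat.leb_spec (q - 2) (w u)) as [E1|E1]; cbn [indic]; [apply Rabs_le; lra|].
    pose proof (Z.div_mod (k + Z.of_nat u * a) (Z.of_nat q) ltac:(lia)) as D.
    set (t := ((k + Z.of_nat u * a) / Z.of_nat q)%Z) in *.
    assert (Ew : Z.of_nat (w u) = ((k + Z.of_nat u * a) mod Z.of_nat q)%Z).
    { unfold w. apply Z2Nat.id. apply Z.mod_pos_bound; lia. }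
    rewrite <- Ew in D. apply (f_equal IZR) in D.
    rewrite !plus_IZR, !mult_IZR, <- !INR_IZR_INZ in D.
    set (g := f + INR u * e).
    assert (Hu' : 0 <= INR u < INR q) by (split; [apply pos_INR|now apply lt_INR]).
    assert (He : - 1 < INR u * e < 1).
    { assert (INR N * Rabs e < 1).
      { apply (Rmult_lt_compat_l (INR N)) in Ha; auto. field_simplify in Ha; lra. }
      assert (Hue : Rabs (INR u * e) < 1).
      { rewrite Rabs_mult, (Rabs_pos_eq (INR u)) by lra. pose proof (Rabs_pos e). nra. }
      apply Rabs_def2 in Hue. lra. }
    assert (Ex : y + INR u * x = IZR t + (INR (w u) + g) / INR q).
    { apply (Rmult_eq_reg_l (INR q)); [|lra].
      replace (INR q * (IZR t + (INR (w u) + g) / INR q)) with (INR q * IZR t + INR (w u) + g) by (field; lra).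
      unfold g. rewrite Rmult_plus_distr_l.
      replace (INR q * (INR u * x)) with (INR u * (e + IZR a)) by (unfold e; ring). lra. }
    assert (Hw1 : 1 <= INR (w u)) by (change 1 with (INR 1); apply le_INR; lia).
    assert (Hw2 : INR (w u) + 3 <= INR q).
    { replace 3 with (INR 3) by (simpl; lra). rewrite <- plus_INR. apply le_INR; lia. }
    rewrite (frac_part_eq _ t).
    - rewrite Ex. replace (IZR t + (INR (w u) + g) / INR q - IZR t - INR (w u) / INR q) with (g / INR q) by (field; lra).
      rewrite !Rplus_0_r. apply Rabs_le. unfold g.
      split; apply (Rmult_le_reg_r (INR q)); auto; field_simplify; lra.
    - rewrite Ex. replace (IZR t + (INR (w u) + g) / INR q - IZR t) with ((INR (w u) + g) / INR q) by ring.
      unfold g. split; [apply Rmult_le_pos; [lra|left; now apply Rinv_0_lt_compat]|].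
      apply (Rmult_lt_reg_r (INR q)); auto. field_simplify; lra. }
  assert (Hperm : forall psi, rsum (fun u => psi (w u)) q = rsum psi q).
  { intros psi. apply rsum_perm; auto. intros i j Hi Hj E.
    destruct (Nat.lt_trichotomy i j) as [L|[L|L]]; auto; exfalso.
    - apply (Hwinj i j); auto; lia.
    - apply (Hwinj j i); auto; lia. }
  assert (Hsum : Rabs (rsum (fun u => frac_part (y + INR u * x) - INR (w u) / INR q) q) <= 5).
  { eapply Rle_trans; [apply rsum_abs|].
    eapply Rle_trans; [apply rsum_le; exact Hpt|].
    rewrite (Hperm (fun v => 2 / INR q + (indic (v =? 0)%nat + indic (q - 2 <=? v)%nat))).
    rewrite !rsum_plus, rsum_const.
    assert (rsum (fun v => indic (v =? 0)%nat) q <= INR 1).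
    { apply (count_close (fun v => (v =? 0)%nat)). intros i j Hij Hi Hj. apply Nat.eqb_eq in Hi, Hj. lia. }
    assert (rsum (fun v => indic (q - 2 <=? v)%nat) q <= INR 2).
    { apply (count_close (fun v => (q - 2 <=? v)%nat)). intros i j Hij Hi Hj. apply Nat.leb_le in Hi, Hj. lia. }
    simpl in *. replace (INR q * (2 / INR q)) with 2 by (field; lra). lra. }
  rewrite (rsum_ext (fun u => frac_part (y + INR u * x) - INR (w u) / INR q)
     (fun u => saw (y + INR u * x) + (1 / 2 + (- / INR q) * INR (w u)))) in Hsum
    by (intros; unfold saw; field; lra).
  rewrite rsum_plus, (Hperm (fun v => 1 / 2 + - / INR q * INR v)), rsum_plus, rsum_const, rsum_scal, rsum_INR in Hsum.
  replace (INR q * (1 / 2) + - / INR q * (INR q * (INR q - 1) / 2)) with (1 / 2) in Hsum by (field; lra).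
  apply Rabs_le. apply Rabs_le_elim in Hsum. lra.
Qed.

(** Let q be least with q x within 1 / N of an integer. Then q >= [q0] by hypothesis and q <= [N] by
    Dirichlet; full periods cost 6 each, the incomplete one at most [N]. *)
Lemma saw_sum x (N q0 : nat) :
  (1 <= N)%nat -> (1 <= q0)%nat ->
  (forall (d : nat) (b : Z), (1 <= d < q0)%nat -> 1 / INR N <= Rabs (INR d * x - IZR b)) ->
  forall y L, Rabs (rsum (fun v => saw (y + INR v * x)) L) <= 6 * INR L / INR q0 + INR N.
Proof.
  intros HN Hq0 Hbad y L.
  destruct (dirichlet x N HN) as [q1 [a1 [Hq1 Ha1]]].
  destruct (least_nat (fun q => (1 <= q)%nat /\ exists a, Rabs (INR q * x - IZR a) < 1 / INR N) q1) as [q [[Hq [a Ha]] Hmin]].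
  { split; [lia|eauto]. }
  assert (Hqq1 : (q <= q1)%nat).
  { destruct (Nat.le_gt_cases q q1); auto. exfalso. apply (Hmin q1); auto. split; [lia|eauto]. }
  assert (Hqq0 : (q0 <= q)%nat).
  { destruct (Nat.le_gt_cases q0 q); auto. specialize (Hbad q a ltac:(lia)). lra. }
  assert (Hp : forall y, Rabs (rsum (fun u => saw (y + INR u * x)) q) <= 6).
  { intros y'. apply (saw_period x y' N q a); auto; [lia|].
    intros d b Hd. apply Rnot_lt_le. intros H. apply (Hmin d); [lia|]. split; [lia|eauto]. }
  assert (H0 : 0 < INR q0) by (apply lt_0_INR; lia).
  pose proof (Nat.div_mod_eq L q) as D. pose proof (Nat.mod_upper_bound L q ltac:(lia)) as Hr.
  set (l := (L / q)%nat) in *. set (r := (L mod q)%nat) in *.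
  rewrite D, (Nat.mul_comm q l), rsum_add, rsum_mul.
  eapply Rle_trans; [apply Rabs_triang|]. apply Rplus_le_compat.
  - eapply Rle_trans; [apply rsum_abs|].
    apply Rle_trans with (rsum (fun _ => 6) l).
    + apply rsum_le. intros i Hi.
      rewrite (rsum_ext _ (fun u => saw ((y + INR (i * q) * x) + INR u * x))); [apply Hp|].
      intros j _. rewrite plus_INR. f_equal. ring.
    + rewrite rsum_const.
      assert (INR l * INR q0 <= INR (l * q + r)) by (rewrite <- mult_INR; apply le_INR; nia).
      apply (Rmult_le_reg_r (INR q0)); auto.
      replace (6 * INR (l * q + r) / INR q0 * INR q0) with (6 * INR (l * q + r)) by (field; lra). lra.
  - eapply Rle_trans; [apply rsum_abs|].
    apply Rle_trans with (rsum (fun _ => 1) r).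
    + apply rsum_le. intros. eapply Rle_trans; [apply saw_bound|lra].
    + rewrite rsum_const, Rmult_1_r. apply le_INR. lia.
Qed.

(* The slowly varying factor wraps around at most once, so saw_sum applies on two intervals. *)
Lemma saw_pair x z (N q0 : nat) eps :
  (1 <= N)%nat -> (1 <= q0)%nat ->
  (forall (d : nat) (b : Z), (1 <= d < q0)%nat -> 1 / INR N <= Rabs (INR d * x - IZR b)) ->
  0 <= z -> forall L, INR L * z <= eps -> eps < 1 ->
  forall y y', Rabs (rsum (fun v => saw (y + INR v * x) * saw (y' + INR v * z)) L)
    <= 6 * INR L / INR q0 + INR N + INR L * eps.
Proof.
  intros HN Hq0 Hbad Hz L HL He y y'.
  pose proof (frac_part_bounds y') as Hfy.
  assert (Hsplit : exists L1, (L1 <= L)%nat /\ forall v, (v < L)%nat ->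
     ((v < L1)%nat -> frac_part y' + INR v * z < 1) /\ ((L1 <= v)%nat -> 1 <= frac_part y' + INR v * z)).
  { clear HL. induction L as [|L [L1 [H1 H2]]]; [exists 0%nat; split; [lia|intros; lia]|].
    destruct (Rlt_dec (frac_part y' + INR L * z) 1) as [H|H].
    - exists (S L). split; [lia|]. intros v Hv. split; [|lia]. intros _.
      assert (INR v <= INR L) by (apply le_INR; lia). nra.
    - exists L1. split; [lia|]. intros v Hv. destruct (Nat.eq_dec v L) as [->|].
      + split; [|intros; lra]. intros HLL. lia.
      + apply H2. lia. }
  destruct Hsplit as [L1 [HL1 Hs]].
  (* Without a wrap the second factor is a constant plus a drift: [saw_sum] handles the constant,
     and the drift is at most [eps] throughout. *)
  assert (Hpiece : forall (y b : R) M, (M <= L)%nat -> Rabs b <= 1 / 2 ->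
     Rabs (rsum (fun v => saw (y + INR v * x) * (b + INR v * z)) M)
       <= 1 / 2 * (6 * INR L / INR q0 + INR N) + INR M * (1 / 2 * eps)).
  { intros yy b M HM Hb.
    assert (HML : INR M <= INR L) by now apply le_INR.
    assert (Hq0' : 0 < INR q0) by (apply lt_0_INR; lia).
    rewrite (rsum_ext _ (fun v => b * saw (yy + INR v * x) + saw (yy + INR v * x) * (INR v * z))) by (intros; ring).
    rewrite rsum_plus, rsum_scal.
    eapply Rle_trans; [apply Rabs_triang|]. apply Rplus_le_compat.
    - rewrite Rabs_mult. apply Rmult_le_compat; auto using Rabs_pos.
      eapply Rle_trans; [apply (saw_sum x N q0); auto|]. apply Rplus_le_compat_r.
      apply Rmult_le_compat_r; [left; now apply Rinv_0_lt_compat|lra].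
    - eapply Rle_trans; [apply rsum_abs|].
      rewrite <- rsum_const. apply rsum_le. intros v Hv.
      rewrite Rabs_mult. apply Rmult_le_compat; auto using Rabs_pos, saw_bound.
      assert (INR v <= INR L) by (apply le_INR; lia). pose proof (pos_INR v).
      rewrite Rabs_pos_eq; nra. }
  destruct (frac_part_int y') as [k Ek].
  replace L with (L1 + (L - L1))%nat at 1 by lia. rewrite rsum_add.
  assert (P1 : Rabs (rsum (fun v => saw (y + INR v * x) * saw (y' + INR v * z)) L1)
     <= 1 / 2 * (6 * INR L / INR q0 + INR N) + INR L1 * (1 / 2 * eps)).
  { rewrite (rsum_ext _ (fun v => saw (y + INR v * x) * (saw y' + INR v * z))).
    - apply Hpiece; auto using saw_bound.
    - intros v Hv. f_equal. destruct (Hs v ltac:(lia)) as [H1 _]. specialize (H1 Hv).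
      pose proof (pos_INR v). unfold saw. rewrite (frac_part_eq (y' + _) k) by nra. lra. }
  assert (P2 : Rabs (rsum (fun i => saw (y + INR (L1 + i) * x) * saw (y' + INR (L1 + i) * z)) (L - L1))
     <= 1 / 2 * (6 * INR L / INR q0 + INR N) + INR (L - L1) * (1 / 2 * eps)).
  { rewrite (rsum_ext _ (fun v => saw ((y + INR L1 * x) + INR v * x) * (saw (y' + INR L1 * z) + INR v * z))).
    - apply Hpiece; auto using saw_bound; lia.
    - intros v Hv. rewrite plus_INR. f_equal; [f_equal; ring|].
      destruct (Hs (L1 + v)%nat ltac:(lia)) as [_ H2]. specialize (H2 ltac:(lia)).
      destruct (Hs L1 ltac:(lia)) as [_ H3]. specialize (H3 ltac:(lia)).
      assert (INR (L1 + v) <= INR L) by (apply le_INR; lia).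
      rewrite plus_INR in *. pose proof (pos_INR v). pose proof (pos_INR L1).
      unfold saw. rewrite !(frac_part_eq _ (k + 1)); rewrite ?plus_IZR; nra. }
  eapply Rle_trans; [apply Rabs_triang|].
  rewrite minus_INR in P2 by auto.
  assert (0 <= eps) by (pose proof (pos_INR L); nra). pose proof (pos_INR L).
  nra.
Qed.

Definition near (eta x : R) : bool :=
  if Rlt_dec (frac_part x) eta then true else if Rlt_dec (1 - eta) (frac_part x) then true else false.

Lemma near_intro eta x k : Rabs (x - IZR k) < eta -> eta <= 1 / 2 -> near eta x = true.
Proof.
  intros H He. apply Rabs_def2 in H. unfold near.
  destruct (Rle_dec (IZR k) x).
  - rewrite (frac_part_eq x k) by lra. destruct (Rlt_dec (x - IZR k) eta); auto; lra.
  - rewrite (frac_part_eq x (k - 1)) by (rewrite minus_IZR; lra). rewrite minus_IZR.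
    destruct (Rlt_dec (x - (IZR k - 1)) eta); auto.
    destruct (Rlt_dec (1 - eta) (x - (IZR k - 1))); auto; lra.
Qed.

Lemma near_elim eta x : near eta x = true -> exists k, Rabs (x - IZR k) < eta.
Proof.
  unfold near. destruct (frac_part_int x) as [k E]. pose proof (frac_part_bounds x).
  destruct (Rlt_dec (frac_part x) eta); [exists k; apply Rabs_def1; lra|].
  destruct (Rlt_dec (1 - eta) (frac_part x)); [|discriminate].
  intros _. exists (k + 1)%Z. rewrite plus_IZR. apply Rabs_def1; lra.
Qed.

(* The progression covers a length at most 1, hence comes close to at most three integers. *)
Lemma near_window theta kap eta n :
  0 < eta <= 1 / 2 -> 0 < Rabs kap <= eta -> INR n * Rabs kap <= 1 ->
  rsum (fun t => indic (near eta (theta + INR t * kap))) n <= 9 * eta / Rabs kap.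
Proof.
  intros He Hk Hn.
  set (m := Rmin theta (theta + INR n * kap)).
  destruct (frac_part_int m) as [f Ef]. pose proof (frac_part_bounds m).
  pose (hit := fun (i : Z) t => if Rlt_dec (Rabs (theta + INR t * kap - IZR i)) eta then true else false).
  assert (Hm : forall t, (t < n)%nat -> m <= theta + INR t * kap <= m + 1).
  { intros t Ht. assert (0 <= INR t <= INR n) by (split; [apply pos_INR|apply le_INR; lia]).
    unfold m, Rmin. destruct (Rle_dec theta (theta + INR n * kap)); destruct (Rle_dec 0 kap);
      [rewrite Rabs_pos_eq in * by lra|rewrite Rabs_left in * by lra|rewrite Rabs_pos_eq in * by lra|rewrite Rabs_left in * by lra]; nra. }
  apply Rle_trans with (rsum (fun t => indic (hit f t) + (indic (hit (f + 1)%Z t) + indic (hit (f + 2)%Z t))) n).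
  { apply rsum_le. intros t Ht. pose proof (indic_nonneg (hit f t)).
    pose proof (indic_nonneg (hit (f + 1)%Z t)). pose proof (indic_nonneg (hit (f + 2)%Z t)).
    destruct (near eta (theta + INR t * kap)) eqn:E; cbn [indic]; [|lra].
    apply near_elim in E as [k Hkk]. specialize (Hm t Ht).
    assert (HH := Rabs_def2 _ _ Hkk).
    assert (f - 1 < k)%Z by (apply lt_IZR; rewrite minus_IZR; lra).
    assert (k < f + 3)%Z by (apply lt_IZR; rewrite plus_IZR; lra).
    assert (Hhit : indic (hit k t) = 1) by (unfold hit; destruct (Rlt_dec _ _); [reflexivity|lra]).
    assert (k = f \/ k = f + 1 \/ k = f + 2)%Z as [-> | [-> | ->]] by lia; lra. }
  assert (Hc : forall i, rsum (fun t => indic (hit i t)) n <= 3 * eta / Rabs kap).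
  { intros i. destruct (floor_nat (2 * eta / Rabs kap)) as [d [Hd1 Hd2]].
    { apply Rmult_le_pos; [lra|left; apply Rinv_0_lt_compat; lra]. }
    apply Rle_trans with (INR (S d)).
    - apply count_close. intros a b Hab Ha Hb. unfold hit in *.
      destruct (Rlt_dec (Rabs (theta + INR a * kap - IZR i)) eta) as [Ha'|]; [|discriminate].
      destruct (Rlt_dec (Rabs (theta + INR b * kap - IZR i)) eta) as [Hb'|]; [|discriminate].
      apply Rabs_def2 in Ha', Hb'.
      assert (Hlt : INR (b - a) * Rabs kap < 2 * eta).
      { rewrite minus_INR by lia. destruct (Rle_dec 0 kap);
        [rewrite Rabs_pos_eq in * by lra|rewrite Rabs_left in * by lra]; nra. }
      assert (INR (b - a) < INR (S d)).
      { rewrite S_INR. eapply Rlt_trans; [|exact Hd2]. apply (Rmult_lt_reg_r (Rabs kap)); [lra|].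
        replace (2 * eta / Rabs kap * Rabs kap) with (2 * eta) by (field; lra). lra. }
      apply INR_lt in H0. lia.
    - rewrite S_INR. assert (1 <= eta / Rabs kap).
      { apply (Rmult_le_reg_r (Rabs kap)); [lra|]. field_simplify; lra. }
      replace (3 * eta / Rabs kap) with (2 * eta / Rabs kap + eta / Rabs kap) by (field; lra). lra. }
  rewrite !rsum_plus.
  pose proof (Hc f). pose proof (Hc (f + 1)%Z). pose proof (Hc (f + 2)%Z).
  replace (9 * eta / Rabs kap) with (3 * eta / Rabs kap + (3 * eta / Rabs kap + 3 * eta / Rabs kap)) by (field; lra).
  lra.
Qed.

(** By Dirichlet some [a * alpha] differs from an integer by [kap] with |kap| < [eta], and
    irrationality keeps [kap] nonzero. Along each class modulo [a] the points advance by [kap] and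
    sweep a length between 1/2 and 1 in [n] steps, where [near_window] applies. The period [n * a]
    does not depend on the shift [c], hence neither does the error. *)
Lemma near_frequency alpha eta :
  (forall (a : nat) (p : Z), (1 <= a)%nat -> INR a * alpha <> IZR p) -> 0 < eta <= 1 / 2 ->
  exists W, forall c J, rsum (fun j => indic (near eta (INR j * alpha - c))) J <= 18 * eta * INR J + W.
Proof.
  intros Hirr He.
  destruct (floor_nat (1 / eta)) as [N0 [_ HN0]].
  { apply Rmult_le_pos; [lra|left; apply Rinv_0_lt_compat; lra]. }
  destruct (dirichlet alpha (S N0) ltac:(lia)) as [a [p [Ha Hap]]].
  set (kap := INR a * alpha - IZR p) in *.
  assert (Hk0 : 0 < Rabs kap).
  { apply Rabs_pos_lt. unfold kap. intros E. apply (Hirr a p); [lia|lra]. }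
  assert (Hk : Rabs kap < eta).
  { eapply Rlt_trans; [exact Hap|]. rewrite S_INR. pose proof (pos_INR N0).
    apply (Rmult_lt_reg_r (INR N0 + 1)); [lra|]. replace (1 / (INR N0 + 1) * (INR N0 + 1)) with 1 by (field; lra).
    apply (Rmult_lt_compat_r eta) in HN0; [|lra]. replace (1 / eta * eta) with 1 in HN0 by (field; lra). lra. }
  destruct (floor_nat (1 / Rabs kap)) as [n [Hn1 Hn2]].
  { apply Rmult_le_pos; [lra|left; apply Rinv_0_lt_compat; lra]. }
  assert (Hn : INR n * Rabs kap <= 1).
  { apply (Rmult_le_compat_r (Rabs kap)) in Hn1; [|lra]. field_simplify in Hn1; lra. }
  assert (Hnl : 1 / 2 <= INR n * Rabs kap).
  { apply (Rmult_lt_compat_r (Rabs kap)) in Hn2; [|lra].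
    replace (1 / Rabs kap * Rabs kap) with 1 in Hn2 by (field; lra). lra. }
  assert (Hnp : (0 < n)%nat) by (destruct n; [simpl in Hnl; lra|lia]).
  set (W := (n * a)%nat).
  assert (Hwin : forall theta, rsum (fun j => indic (near eta (theta + INR j * alpha))) W <= 18 * eta * INR W).
  { intros theta. unfold W. rewrite rsum_mul, rsum_swap.
    apply Rle_trans with (rsum (fun _ => 9 * eta / Rabs kap) a).
    - apply rsum_le. intros r Hr.
      eapply Rle_trans; [|apply (near_window (theta + INR r * alpha) kap eta n); lra].
      apply Req_le, rsum_ext. intros t Ht. f_equal. rewrite plus_INR, mult_INR.
      replace (theta + (INR t * INR a + INR r) * alpha)
        with (theta + INR r * alpha + INR t * kap + IZR (Z.of_nat t * p)).
      + unfold near. now rewrite frac_part_shift.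
      + rewrite mult_IZR, <- INR_IZR_INZ. unfold kap. ring.
    - rewrite rsum_const, mult_INR.
      assert (9 * eta / Rabs kap <= 18 * eta * INR n).
      { apply (Rmult_le_reg_r (Rabs kap)); [lra|].
        replace (9 * eta / Rabs kap * Rabs kap) with (9 * eta) by (field; lra). nra. }
      pose proof (pos_INR a). nra. }
  exists (18 * eta * INR W). intros c J.
  assert (HW0 : (0 < W)%nat) by (unfold W; nia).
  assert (HJ : (J <= (J / W + 1) * W)%nat).
  { pose proof (Nat.div_mod_eq J W). pose proof (Nat.mod_upper_bound J W ltac:(lia)). nia. }
  apply Rle_trans with (rsum (fun j => indic (near eta (INR j * alpha - c))) ((J / W + 1) * W)).
  { replace ((J / W + 1) * W)%nat with (J + ((J / W + 1) * W - J))%nat by lia. rewrite rsum_add.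
    match goal with |- _ <= _ + ?b => assert (0 <= b) by (apply rsum_nonneg; intros; apply indic_nonneg) end. lra. }
  rewrite rsum_mul.
  apply Rle_trans with (rsum (fun _ => 18 * eta * INR W) (J / W + 1)).
  - apply rsum_le. intros i _.
    eapply Rle_trans; [|apply (Hwin (INR (i * W) * alpha - c))].
    apply Req_le, rsum_ext. intros j _. f_equal. f_equal. rewrite plus_INR. ring.
  - rewrite rsum_const, plus_INR.
    assert (INR (J / W) * INR W <= INR J).
    { rewrite <- mult_INR. apply le_INR. pose proof (Nat.Div0.mul_div_le J W). lia. }
    change (INR 1) with 1. nra.
Qed.

(** * Second moment over sparse numbers *)

(* Average of F (x + v_0 g_0 + ... + v_(S-1) g_(S-1)) over all v with entries below V. *)
Fixpoint av (g : nat -> nat) (V S : nat) (F : nat -> R) (x : nat) : R :=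
  match S with
  | O => F x
  | S k => / INR V * rsum (fun v => av g V k F (x + v * g k)%nat) V
  end.

Lemma av_le g V S F G x : (0 < V)%nat -> (forall y, F y <= G y) -> av g V S F x <= av g V S G x.
Proof.
  intros HV H. revert x. induction S as [|S IH]; intros x; simpl; [auto|].
  apply Rmult_le_compat_l; [left; now apply Rinv_0_lt_compat, lt_0_INR|]. apply rsum_le; auto.
Qed.

Lemma av_ext g V S F G x : (0 < V)%nat -> (forall y, F y = G y) -> av g V S F x = av g V S G x.
Proof. intros HV H. apply Rle_antisym; apply av_le; intros; rewrite ?H; auto; lra. Qed.

Lemma av_rsum g V S (F : nat -> nat -> R) n x :
  av g V S (fun y => rsum (fun i => F i y) n) x = rsum (fun i => av g V S (F i) x) n.
Proof.
  revert x. induction S as [|S IH]; intros x; simpl; [auto|].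
  rewrite (rsum_ext _ _ _ (fun v _ => IH _)), rsum_swap, rsum_scal. reflexivity.
Qed.

Lemma av_shift g V S F x d : av g V S F (x + d) = av g V S (fun y => F (y + d)%nat) x.
Proof.
  revert x. induction S as [|S IH]; intros x; simpl; [auto|].
  f_equal. apply rsum_ext. intros v _. rewrite <- IH. f_equal. lia.
Qed.

Lemma av_const g V S c x : (0 < V)%nat -> av g V S (fun _ => c) x = c.
Proof.
  intros HV. revert x. induction S as [|S IH]; intros x; simpl; [auto|].
  rewrite (rsum_ext _ _ _ (fun v _ => IH _)), rsum_const. field. apply not_0_INR; lia.
Qed.

Lemma av_le_const g V S F b x : (0 < V)%nat -> (forall y, F y <= b) -> av g V S F x <= b.
Proof. intros HV H. rewrite <- (av_const g V S b x HV). now apply av_le. Qed.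

(** Cancellation in a single coordinate suffices: it holds for all values of the others, and
    averaging over them preserves it. *)
Lemma av_coordinate g V S F b s x : (0 < V)%nat -> (s < S)%nat ->
  (forall y, rsum (fun v => F (y + v * g s)%nat) V <= INR V * b) -> av g V S F x <= b.
Proof.
  intros HV Hs H. pose proof (lt_0_INR V HV) as HV0.
  revert x. induction S as [|S IH]; intros x; [lia|]. simpl.
  apply (Rmult_le_reg_l (INR V)); auto. rewrite <- Rmult_assoc, Rinv_r, Rmult_1_l by lra.
  destruct (Nat.eq_dec s S) as [->|N].
  - rewrite (rsum_ext _ _ _ (fun v _ => av_shift _ _ _ _ _ _)), <- av_rsum. now apply av_le_const.
  - rewrite <- rsum_const. apply rsum_le. intros; apply IH; lia.
Qed.

Lemma av_attained g V S F x : (0 < V)%nat -> exists v : nat -> nat, (forall s, (s < S)%nat -> (v s < V)%nat) /\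
  F (x + nsum (fun s => v s * g s) S)%nat <= av g V S F x.
Proof.
  intros HV. pose proof (lt_0_INR V HV) as HV0.
  revert x. induction S as [|S IH]; intros x; simpl.
  - exists (fun _ => O). split; [lia|]. rewrite Nat.add_0_r. lra.
  - destruct (rsum_exists_le (fun v => av g V S F (x + v * g S)%nat) V
      (/ INR V * rsum (fun v => av g V S F (x + v * g S)%nat) V)) as [v0 [Hv0 Hle]]; auto.
    { apply Req_le. field. lra. }
    destruct (IH (x + v0 * g S)%nat) as [v [Hv HF]].
    exists (fun s => if (s =? S)%nat then v0 else v s). split.
    + intros s Hs. destruct (Nat.eqb_spec s S); auto. apply Hv; lia.
    + rewrite Nat.eqb_refl.
      rewrite (nsum_ext _ (fun s => v s * g s)%nat).
      * eapply Rle_trans; [|exact Hle].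
        replace (x + (nsum (fun s => v s * g s) S + v0 * g S))%nat
          with (x + v0 * g S + nsum (fun s => v s * g s) S)%nat by lia. exact HF.
      * intros i Hi. destruct (Nat.eqb_spec i S); [lia|reflexivity].
Qed.

(** Expand the square. Pairs at distance below [Delta] or involving a bad position are bounded
    trivially; the others decorrelate through one block. Taking [bad] real, with 1 as threshold,
    lets a sum of indicators serve directly. *)
Lemma second_moment g V S J Delta (f : nat -> nat -> R) (bad : nat -> R) eps x :
  (0 < V)%nat -> 0 <= eps -> (forall j y, Rabs (f j y) <= 1 / 2) -> (forall j, 0 <= bad j) ->
  (forall j j', (j + Delta <= j')%nat -> (j' < J)%nat -> bad j < 1 ->
     exists s, (s < S)%nat /\ forall y, rsum (fun v => f j (y + v * g s)%nat * f j' (y + v * g s)%nat) V <= INR V * eps) ->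
  av g V S (fun y => rsum (fun j => f j y) J * rsum (fun j => f j y) J) x
    <= eps * INR J * INR J + 2 * INR Delta * INR J + 2 * INR J * rsum bad J.
Proof.
  intros HV He Hf Hb Hp.
  rewrite (av_ext _ _ _ _ (fun y => rsum (fun i => rsum (fun j => f i y * f j y) J) J)) by (auto; intros; apply rsum_sq).
  rewrite av_rsum, (rsum_ext _ _ _ (fun i _ => av_rsum _ _ _ _ _ _)).
  pose (close := fun i j => (andb (j <? i + Delta) (i <? j + Delta))%nat).
  assert (Hall : forall i j, (i < J)%nat -> (j < J)%nat ->
     av g V S (fun y => f i y * f j y) x <= (eps + indic (close i j)) + (bad i + bad j)).
  { assert (Ht : forall i j, av g V S (fun y => f i y * f j y) x <= 1).
    { intros i j. apply av_le_const; auto. intros y.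
      pose proof (Rabs_le_elim _ _ (Hf i y)). pose proof (Rabs_le_elim _ _ (Hf j y)). nra. }
    intros i j Hi Hj. specialize (Ht i j). pose proof (Hb i). pose proof (Hb j).
    destruct (close i j) eqn:Ec; cbn [indic]; [lra|].
    destruct (Rlt_dec (bad i) 1) as [Bi|]; [|lra]. destruct (Rlt_dec (bad j) 1) as [Bj|]; [|lra].
    assert (av g V S (fun y => f i y * f j y) x <= eps); [|lra].
    unfold close in Ec. apply Bool.andb_false_iff in Ec as [Ec|Ec]; apply Nat.ltb_ge in Ec.
    - destruct (Hp i j Ec Hj Bi) as [s [Hs H1]]. now apply (av_coordinate g V S _ eps s).
    - destruct (Hp j i Ec Hi Bj) as [s [Hs H1]]. apply (av_coordinate g V S _ eps s); auto.
      intros y. rewrite (rsum_ext _ (fun v => f j (y + v * g s)%nat * f i (y + v * g s)%nat)) by (intros; ring). auto. }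
  apply Rle_trans with (rsum (fun i => (INR J * eps + 2 * INR Delta) + (INR J * bad i + rsum bad J)) J).
  - apply rsum_le. intros i Hi.
    eapply Rle_trans; [apply rsum_le; intros j Hj; apply (Hall i j Hi Hj)|].
    rewrite !rsum_plus, !rsum_const.
    assert (rsum (fun j => indic (close i j)) J <= INR (2 * Delta)); [|rewrite mult_INR in H; simpl (INR 2) in H; lra].
    apply (count_close (close i)). intros a b Hab Ha Hbb. unfold close in *.
    apply andb_prop in Ha as [Ha1 Ha2], Hbb as [Hb1 Hb2]. apply Nat.ltb_lt in Ha1, Ha2, Hb1, Hb2. lia.
  - rewrite !rsum_plus, !rsum_const, rsum_scal. lra.
Qed.

(* The digit at position k is q {N / q^(k+1)} - {N / q^k}. *)
Lemma digit_sum_frac q N U J : (2 <= q)%nat -> (N < q ^ (U + J))%nat ->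
  INR (digit_sum q (N / q ^ U)) =
    (INR q - 1) * rsum (fun j => frac_part (INR N / INR (q ^ (U + 1 + j)))) J
    + frac_part (INR N / INR (q ^ (U + J))) - frac_part (INR N / INR (q ^ U)).
Proof.
  intros Hq.
  assert (Hfr : forall k, frac_part (INR N / INR (q ^ k)) = INR (N mod q ^ k) / INR (q ^ k)).
  { intros k. pose proof (npow_pos q k Hq) as Hp. pose proof (lt_0_INR _ Hp) as Hp'.
    pose proof (Nat.div_mod_eq N (q ^ k)) as D. apply (f_equal INR) in D. rewrite plus_INR, mult_INR in D.
    pose proof (Nat.mod_upper_bound N (q ^ k) ltac:(lia)) as Hm. apply lt_INR in Hm.
    pose proof (pos_INR (N mod q ^ k)).
    assert (E : INR N / INR (q ^ k) - IZR (Z.of_nat (N / q ^ k)) = INR (N mod q ^ k) / INR (q ^ k)).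
    { rewrite D, <- INR_IZR_INZ. field. lra. }
    rewrite (frac_part_eq _ (Z.of_nat (N / q ^ k))); rewrite E; auto.
    split; [apply Rmult_le_pos; [auto|left; now apply Rinv_0_lt_compat]|].
    apply (Rmult_lt_reg_r (INR (q ^ k))); auto. field_simplify; lra. }
  revert U. induction J as [|J IH]; intros U HN.
  - rewrite Nat.add_0_r in *. rewrite Nat.div_small, digit_sum_0 by auto. simpl. lra.
  - replace (U + S J)%nat with (U + 1 + J)%nat in * by lia.
    specialize (IH (U + 1)%nat HN).
    rewrite digit_sum_step, Nat.Div0.div_div by auto.
    replace (q ^ U * q)%nat with (q ^ (U + 1))%nat by (rewrite Nat.add_1_r, Nat.pow_succ_r'; ring).
    rewrite plus_INR, IH.
    replace (S J) with (1 + J)%nat by lia. rewrite rsum_add. cbn [rsum].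
    rewrite Nat.add_0_r.
    rewrite (rsum_ext (fun i => frac_part (INR N / INR (q ^ (U + 1 + (1 + i)))))
                      (fun j => frac_part (INR N / INR (q ^ (U + 1 + 1 + j)))))
      by (intros; do 4 f_equal; lia).
    assert (E : INR ((N / q ^ U) mod q) = INR q * frac_part (INR N / INR (q ^ (U + 1))) - frac_part (INR N / INR (q ^ U))).
    { rewrite !Hfr. pose proof (npow_pos q U Hq) as Hp. apply lt_0_INR in Hp.
      assert (0 < INR q) by (apply lt_0_INR; lia).
      replace (q ^ (U + 1))%nat with (q ^ U * q)%nat by (rewrite Nat.add_1_r, Nat.pow_succ_r'; ring).
      rewrite Nat.Div0.mod_mul_r, plus_INR, !mult_INR. field. lra. }
    rewrite E. ring.
Qed.

(** Ones and zeros suffice in either base, because the sum asked for is at most the number of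
    digits. *)
Lemma digit_sum_filler q d a : (2 <= q)%nat -> (a <= d)%nat ->
  exists u, (u < q ^ d)%nat /\ digit_sum q u = a.
Proof.
  intros Hq. revert a. induction d as [|d IH]; intros a Ha.
  - exists O. simpl. split; [lia|]. rewrite digit_sum_0; lia.
  - destruct a as [|a]; [exists O; split; [now apply npow_pos|reflexivity]|].
    destruct (IH a ltac:(lia)) as [u [Hu Du]].
    exists (u * q + 1)%nat. rewrite Nat.pow_succ_r'. split; [nia|].
    rewrite digit_sum_cons by lia. lia.
Qed.

Lemma digit_sum_fillers q d S K : (2 <= q)%nat -> (K <= d * S)%nat ->
  exists u : nat -> nat, (forall s, (s < S)%nat -> (u s < q ^ d)%nat) /\
    nsum (fun s => digit_sum q (u s)) S = K.
Proof.
  intros Hq. revert K. induction S as [|S IH]; intros K HK.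
  - exists (fun _ => O). split; [lia|]. simpl. lia.
  - destruct (IH (K - Nat.min K d)%nat ltac:(lia)) as [u [Hu Du]].
    destruct (digit_sum_filler q d (Nat.min K d) Hq ltac:(lia)) as [u0 [Hu0 Du0]].
    exists (fun s => if (s =? S)%nat then u0 else u s). split.
    + intros s Hs. destruct (Nat.eqb_spec s S); auto. apply Hu; lia.
    + cbn [nsum]. rewrite Nat.eqb_refl, (nsum_ext _ (fun s => digit_sum q (u s))); [lia|].
      intros i Hi. destruct (Nat.eqb_spec i S); [lia|reflexivity].
Qed.

Lemma ln_pred_le t : 0 < t -> ln t <= t - 1.
Proof.
  intros Ht. pose proof (exp_ineq1_le (ln t)) as H. rewrite exp_ln in H by auto. lra.
Qed.

Lemma ln_near_1 t : Rabs (t - 1) <= 1 / 2 -> Rabs (ln t) <= 2 * Rabs (t - 1).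
Proof.
  intros H. pose proof (Rabs_le_elim _ _ H) as H'.
  assert (Ht : 0 < t) by lra.
  pose proof (ln_pred_le t Ht) as U.
  pose proof (ln_pred_le (/ t) ltac:(now apply Rinv_0_lt_compat)) as L.
  rewrite ln_Rinv in L by auto.
  assert (L2 : - (2 * Rabs (t - 1)) <= 1 - / t).
  { apply (Rmult_le_reg_r t); auto. rewrite Rmult_minus_distr_r, Rinv_l by lra.
    unfold Rabs. destruct (Rcase_abs (t - 1)); nra. }
  pose proof (Rle_abs (t - 1)). pose proof (Rabs_pos (t - 1)).
  apply Rabs_le. lra.
Qed.

Lemma harmonic_le M : (1 <= M)%nat -> rsum (fun m => / INR (S m)) M <= 1 + ln (INR M).
Proof.
  induction M as [|M IH]; intros HM; [lia|].
  destruct (Nat.eq_dec M 0) as [->|N].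
  - simpl. rewrite ln_1, Rinv_1. lra.
  - cbn [rsum]. specialize (IH ltac:(lia)).
    assert (H0 : 0 < INR M) by (apply lt_0_INR; lia).
    pose proof (S_INR M) as HS.
    pose proof (ln_pred_le (INR M / INR (S M)) ltac:(apply Rdiv_lt_0_compat; lra)) as H.
    unfold Rdiv in H. rewrite ln_mult, ln_Rinv in H by (try apply Rinv_0_lt_compat; lra).
    replace (INR M * / INR (S M) - 1) with (- / INR (S M)) in H by (rewrite HS; field; lra). lra.
Qed.

Lemma ln_INR_pow q k : (2 <= q)%nat -> ln (INR (q ^ k)) = INR k * ln (INR q).
Proof. intros Hq. rewrite pow_INR, ln_pow; auto. apply lt_0_INR; lia. Qed.

Lemma pair23_ln q1 q2 : pair23 q1 q2 -> 1 / 2 < ln (INR q1) /\ ln (INR q1) <= 2 * ln (INR q2).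
Proof.
  intros Hp. pose proof ln_lt_2.
  assert (ln 2 < ln 3) by (apply ln_increasing; lra).
  assert (ln 3 < ln 4) by (apply ln_increasing; lra).
  replace 4 with (2 * 2) in H1 by lra. rewrite ln_mult in H1 by lra.
  destruct Hp as [[-> ->]|[-> ->]]; simpl INR; replace (1 + 1 + 1) with 3 by lra; replace (1 + 1) with 2 by lra; lra.
Qed.

(** A rational value would make a positive power of [q2] equal to a power of [q1], against
    coprimality. *)
Lemma pair23_irrational q1 q2 D : pair23 q1 q2 -> (1 <= D)%nat ->
  forall (a : nat) (p : Z), (1 <= a)%nat -> INR a * (ln (INR q2) / (INR D * ln (INR q1))) <> IZR p.
Proof.
  intros Hp HD a p Ha E.
  assert (Hq1 : (2 <= q1)%nat) by (destruct Hp; lia). assert (Hq2 : (2 <= q2)%nat) by (destruct Hp; lia).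
  destruct (pair23_ln q1 q2 Hp) as [L1 _]. destruct (pair23_ln q2 q1 (pair23_sym _ _ Hp)) as [L2 _].
  assert (HD0 : 0 < INR D) by (apply lt_0_INR; lia).
  assert (Ha0 : 0 < INR a) by (apply lt_0_INR; lia).
  assert (HDl : 0 < INR D * ln (INR q1)) by nra.
  assert (E2 : INR a * ln (INR q2) = IZR p * (INR D * ln (INR q1))).
  { rewrite <- E. field. nra. }
  assert (Hpos : 0 < IZR p) by nra. apply lt_IZR in Hpos.
  assert (E3 : ln (INR (q2 ^ a)) = ln (INR (q1 ^ (Z.to_nat p * D)))).
  { rewrite !ln_INR_pow, mult_INR by auto. rewrite (INR_IZR_INZ (Z.to_nat p)), Z2Nat.id by lia. lra. }
  pose proof (npow_pos q2 a Hq2). pose proof (npow_pos q1 (Z.to_nat p * D) Hq1).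
  apply ln_inv in E3; [|apply lt_0_INR; auto..]. apply INR_eq in E3.
  assert (Dv : Nat.divide (q2 ^ a) 1).
  { apply (pair23_divide q2 q1 a (Z.to_nat p * D)); [now apply pair23_sym|].
    exists 1%nat. lia. }
  apply Nat.divide_pos_le in Dv; [|lia].
  assert (q2 ^ 1 <= q2 ^ a)%nat by (apply Nat.pow_le_mono_r; lia). simpl in H1. lia.
Qed.

(** The order of quantifiers is the point: [W] precedes the shifts [c], which will depend on the
    lengths in play and so on the targets. *)
Lemma near_total alpha q0 M (eta : nat -> R) :
  (forall (a : nat) (p : Z), (1 <= a)%nat -> INR a * alpha <> IZR p) ->
  (forall m, (m < M)%nat -> 0 < eta m <= 1 / 2) ->
  exists W, forall (c : nat -> nat -> R) J,
    rsum (fun j => rsum (fun d => rsum (fun m => indic (near (eta m) (INR j * alpha - c d m))) M) q0) J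
      <= 18 * INR q0 * rsum eta M * INR J + W.
Proof.
  intros Hirr Heta.
  assert (H : exists W, forall (c : nat -> R) J,
    rsum (fun m => rsum (fun j => indic (near (eta m) (INR j * alpha - c m))) J) M <= 18 * rsum eta M * INR J + W).
  { induction M as [|M IH].
    - exists 0. intros. simpl. lra.
    - destruct IH as [W HW]; [auto|].
      destruct (near_frequency alpha (eta M) Hirr (Heta M ltac:(lia))) as [W1 HW1].
      exists (W + W1). intros c J. cbn [rsum]. specialize (HW c J). specialize (HW1 (c M) J). lra. }
  destruct H as [W HW]. exists (INR q0 * W). intros c J.
  rewrite rsum_swap.
  apply Rle_trans with (rsum (fun _ => 18 * rsum eta M * INR J + W) q0).
  - apply rsum_le. intros d _. rewrite rsum_swap. apply HW.
  - rewrite rsum_const. apply Req_le. ring.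
Qed.

(* At position U+1+j the block of base-q1 digits just above it equidistributes the
   fractional part, unless j lies in one of the exceptional arcs. *)
Lemma good_position q1 q2 D R E U S J q0 N Delta eps j j' :
  pair23 q1 q2 -> (1 <= D)%nat -> (R <= D)%nat -> (1 <= S)%nat -> (12 <= N)%nat -> (1 <= q0)%nat ->
  (q1 ^ (E + 1) < q1 ^ D * q2 ^ U)%nat ->
  (forall k, (q1 ^ (E + 1 + D * S) <= q2 ^ k)%nat -> (U + J <= k)%nat) ->
  (j + 2 * D + 3 <= J)%nat -> (j + Delta <= j')%nat ->
  INR (q1 ^ (2 * D)) <= eps * INR (q2 ^ Delta) -> eps < 1 ->
  (forall d m, (1 <= d < q0)%nat -> (1 <= m <= q0 * q1 ^ D)%nat ->
     near (3 / (INR N * INR m * (INR D * ln (INR q1))))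
       (INR j * (ln (INR q2) / (INR D * ln (INR q1))) -
        ((INR (E + 1) * ln (INR q1) + ln (INR d) - ln (INR m) - INR (U + 1) * ln (INR q2)) / (INR D * ln (INR q1)))) = false) ->
  exists s, (s < S)%nat /\ forall y,
    rsum (fun v => saw (INR (y + v * q1 ^ (E + 1 + D * s)) / INR (q2 ^ (U + 1 + j)))
                 * saw (INR (y + v * q1 ^ (E + 1 + D * s)) / INR (q2 ^ (U + 1 + j')))) (q1 ^ R)
      <= 6 * INR (q1 ^ R) / INR q0 + INR N + INR (q1 ^ R) * eps.
Proof.
  intros Hp HD HR HS HN Hq0 HE HJ Hj Hjj' HDelta Heps Hnear.
  assert (Hq1 : (2 <= q1)%nat) by (destruct Hp; lia). assert (Hq2 : (2 <= q2)%nat) by (destruct Hp; lia).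
  destruct (pair23_ln q1 q2 Hp) as [L1 _].
  set (k := (U + 1 + j)%nat) in *.
  (* Since [j] stays [2 * D + 3] below [J] and [q1 ^ D <= q2 ^ (2 * D)], at least the top block
     starts no lower than [q2 ^ k]. *)
  assert (Htop : (q2 ^ k <= q1 ^ (E + 1 + D * (S - 1)))%nat).
  { destruct (Nat.le_gt_cases (q2 ^ k) (q1 ^ (E + 1 + D * (S - 1)))) as [|Hlt]; auto. exfalso.
    assert (H1 : (q1 ^ D <= q2 ^ (2 * D))%nat) by (apply pair23_sq; now apply pair23_sym).
    specialize (HJ (k + 2 * D)%nat). rewrite (Nat.pow_add_r q2) in HJ.
    replace (E + 1 + D * S)%nat with (E + 1 + D * (S - 1) + D)%nat in HJ by nia.
    rewrite (Nat.pow_add_r q1 _ D) in HJ. specialize (HJ ltac:(nia)). unfold k in HJ. lia. }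
  (* The lowest such block: its rotation number [q1 ^ i / q2 ^ k] lies between 1 and [q1 ^ D], which
     bounds the numerators [m] by [q0 * q1 ^ D]. *)
  destruct (least_nat (fun s => (q2 ^ k <= q1 ^ (E + 1 + D * s))%nat) (S - 1) Htop) as [s [Hs Hmin]].
  assert (HsS : (s < S)%nat).
  { destruct (Nat.le_gt_cases s (S - 1)); [lia|]. exfalso. now apply (Hmin (S - 1)%nat). }
  set (i := (E + 1 + D * s)%nat) in *.
  pose proof (npow_pos q1 D Hq1) as HDp. pose proof (npow_pos q2 k Hq2) as Hkp.
  assert (Hup : (q1 ^ i < q1 ^ D * q2 ^ k)%nat).
  { destruct s as [|s].
    - unfold i. rewrite Nat.mul_0_r, Nat.add_0_r.
      assert (q2 ^ U <= q2 ^ k)%nat by (apply Nat.pow_le_mono_r; unfold k; lia). nia.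
    - specialize (Hmin s ltac:(lia)). unfold i.
      replace (E + 1 + D * Datatypes.S s)%nat with (D + (E + 1 + D * s))%nat by nia.
      rewrite Nat.pow_add_r. nia. }
  set (G := INR (q1 ^ i)). set (Q := INR (q2 ^ k)).
  assert (HQ : 0 < Q) by (apply lt_0_INR; auto).
  assert (HGQ : Q <= G) by (apply le_INR; auto).
  assert (HGU : G < INR (q1 ^ D) * Q) by (unfold G, Q; rewrite <- mult_INR; now apply lt_INR).
  assert (HN0 : 12 <= INR N) by (replace 12 with (INR 12) by (simpl; lra); now apply le_INR).
  exists s. split; auto. intros y. fold i.
  rewrite (rsum_ext _ (fun v => saw (INR y / Q + INR v * (G / Q)) * saw (INR y / INR (q2 ^ (U + 1 + j')) + INR v * (G / INR (q2 ^ (U + 1 + j')))))).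
  2:{ intros v _. rewrite plus_INR, mult_INR. fold G Q. f_equal; f_equal; unfold Rdiv; ring. }
  eapply Rle_trans; [apply Rle_abs|].
  assert (Hk'p : 0 < INR (q2 ^ (U + 1 + j'))) by (apply lt_0_INR; now apply npow_pos).
  apply saw_pair; auto; [lia| | |].
  - intros d b Hd. apply Rnot_lt_le. intros Hlt.
    assert (HN1 : 1 / INR N <= 1 / 12) by (apply Rmult_le_compat_l; [lra|apply Rinv_le_contravar; lra]).
    assert (Hd1 : 1 <= INR d) by (change 1 with (INR 1); apply le_INR; lia).
    assert (Hx1 : 1 <= G / Q).
    { apply (Rmult_le_reg_r Q); auto. field_simplify; lra. }
    assert (Hx2 : G / Q < INR (q1 ^ D)).
    { apply (Rmult_lt_reg_r Q); auto. field_simplify; lra. }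
    set (X := G / Q) in *.
    apply Rabs_def2 in Hlt as Hlt2.
    assert (Hb0 : (0 < b)%Z) by (apply lt_IZR; nra).
    pose (m := Z.to_nat b).
    assert (Hm : IZR b = INR m) by (unfold m; rewrite INR_IZR_INZ, Z2Nat.id; [auto|lia]).
    assert (Hm1 : (1 <= m)%nat) by (unfold m; lia).
    assert (Hm1' : 1 <= INR m) by (change 1 with (INR 1); now apply le_INR).
    assert (Hm2 : (m <= q0 * q1 ^ D)%nat).
    { apply INR_le. rewrite mult_INR.
      assert (INR d + 1 <= INR q0) by (rewrite <- S_INR; apply le_INR; lia).
      assert (1 <= INR (q1 ^ D)) by (change 1 with (INR 1); apply le_INR; lia).
      assert (INR d * X <= INR d * INR (q1 ^ D)) by (apply Rmult_le_compat_l; lra).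
      assert ((INR d + 1) * INR (q1 ^ D) <= INR q0 * INR (q1 ^ D)) by (apply Rmult_le_compat_r; lra). lra. }
    specialize (Hnear d m Hd ltac:(lia)).
    assert (HDl : 0 < INR D) by (apply lt_0_INR; lia).
    set (T := INR D * ln (INR q1)) in *.
    assert (HT : 1 / 2 <= T).
    { unfold T. assert (1 <= INR D) by (change 1 with (INR 1); now apply le_INR). nra. }
    assert (HNm : 12 <= INR N * INR m) by nra.
    assert (HNmT : 6 <= INR N * INR m * T) by nra.
    (* If [d * X] is within 1 / N of [m], then |ln (d X / m)| is at most 2 / (N m). Divided by [T]
       it is, up to sign, the tested expression minus the integer [s]; the 3 in place of 2 makes the
       inequality strict. *)
    rewrite (near_intro _ _ (Z.of_nat s)) in Hnear; [discriminate| |].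
    + rewrite <- INR_IZR_INZ.
      assert (Et : Rabs (INR d * X / INR m - 1) < 1 / (INR N * INR m)).
      { replace (INR d * X / INR m - 1) with ((INR d * X - INR m) * / INR m) by (field; lra).
        rewrite Rabs_mult, (Rabs_pos_eq (/ INR m)) by (left; apply Rinv_0_lt_compat; lra).
        rewrite Hm in Hlt. apply (Rmult_lt_compat_r (/ INR m)) in Hlt; [|apply Rinv_0_lt_compat; lra].
        eapply Rlt_le_trans; [exact Hlt|]. apply Req_le. field. lra. }
      assert (H12 : 1 / (INR N * INR m) <= 1 / 12) by (apply Rmult_le_compat_l; [lra|apply Rinv_le_contravar; lra]).
      pose proof (ln_near_1 (INR d * X / INR m) ltac:(lra)) as Hln.
      assert (EX : ln (INR d * X / INR m) = ln (INR d) + (INR i * ln (INR q1) - INR k * ln (INR q2)) - ln (INR m)).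
      { unfold X, Rdiv. rewrite !ln_mult, !ln_Rinv by (repeat apply Rmult_lt_0_compat; try apply Rinv_0_lt_compat; lra).
        unfold G, Q. rewrite !ln_INR_pow by auto. ring. }
      match goal with |- Rabs ?A < _ => replace A with (- (ln (INR d * X / INR m) / T)) end.
      * rewrite Rabs_Ropp. unfold Rdiv at 1. rewrite Rabs_mult, (Rabs_pos_eq (/ T)) by (left; apply Rinv_0_lt_compat; lra).
        apply (Rmult_lt_reg_r T); [lra|]. rewrite Rmult_assoc, Rinv_l, Rmult_1_r by lra.
        replace (3 / (INR N * INR m * T) * T) with (3 * (1 / (INR N * INR m))) by (field; repeat split; lra).
        assert (0 < 1 / (INR N * INR m)) by (apply Rdiv_lt_0_compat; lra). lra.
      * rewrite EX. apply (Rmult_eq_reg_r T); [|lra].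
        unfold i, k. rewrite !(plus_INR), mult_INR. field_simplify; [|lra|lra]. unfold T. simpl (INR 1). field_simplify; [lra|lra..].
    + apply (Rmult_le_reg_r (INR N * INR m * T)); [lra|]. field_simplify; [lra|]. repeat split; lra.
  - apply Rmult_le_pos; [lra|left; now apply Rinv_0_lt_compat].
  - assert (Hkk : (q2 ^ k * q2 ^ Delta <= q2 ^ (U + 1 + j'))%nat).
    { rewrite <- Nat.pow_add_r. apply Nat.pow_le_mono_r; unfold k; lia. }
    apply le_INR in Hkk. rewrite mult_INR in Hkk. fold Q in Hkk.
    apply (Rmult_le_reg_r (INR (q2 ^ (U + 1 + j')))); auto.
    replace (INR (q1 ^ R) * (G / INR (q2 ^ (U + 1 + j'))) * INR (q2 ^ (U + 1 + j'))) with (INR (q1 ^ R) * G) by (field; lra).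
    assert (HRD : INR (q1 ^ R) <= INR (q1 ^ D)) by (apply le_INR, Nat.pow_le_mono_r; lia).
    assert (E2 : INR (q1 ^ (2 * D)) = INR (q1 ^ D) * INR (q1 ^ D)) by (rewrite <- mult_INR, <- Nat.pow_add_r; f_equal; f_equal; lia).
    rewrite E2 in HDelta.
    assert (HDp' : 0 < INR (q1 ^ D)) by (apply lt_0_INR; auto).
    assert (H2p : 0 < INR (q2 ^ Delta)) by (apply lt_0_INR; now apply npow_pos).
    assert (0 < eps) by nra.
    apply Rle_trans with (INR (q1 ^ D) * (INR (q1 ^ D) * Q)).
    { apply Rmult_le_compat; try lra; apply pos_INR. }
    apply Rle_trans with (eps * (Q * INR (q2 ^ Delta))); nra.
Qed.

Lemma pow_ge_exponent q n : (2 <= q)%nat -> INR n <= INR (q ^ n).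
Proof. intros Hq. apply le_INR, Nat.lt_le_incl, Nat.pow_gt_lin_r; lia. Qed.

Lemma nsum_plus f g n : nsum (fun i => f i + g i)%nat n = (nsum f n + nsum g n)%nat.
Proof. induction n as [|n IH]; simpl; lia. Qed.

Lemma nsum_bound f b n : (forall i, (i < n)%nat -> (f i <= b)%nat) -> (nsum f n <= n * b)%nat.
Proof. induction n as [|n IH]; intros H; simpl; [lia|]. pose proof (H n ltac:(lia)). specialize (IH ltac:(auto)). lia. Qed.

Lemma nsum_multiple f q e n : (forall i, exists k, f i = (k * q ^ e)%nat) -> (nsum f n mod q ^ e = 0)%nat.
Proof.
  intros H. assert (E : exists k, nsum f n = (k * q ^ e)%nat).
  { induction n as [|n [k IH]]; [exists O; reflexivity|]. destruct (H n) as [k' Hk']. simpl.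
    exists (k + k')%nat. rewrite IH, Hk'. ring. }
  destruct E as [k ->]. apply Nat.Div0.mod_mul.
Qed.

(** [J] is the number of base-[q2] digits above position [u + 1] matching [L] base-[q1] digits above
    [E + 1]; both roundings together cost at most 2. *)
Lemma sparse_length q1 q2 E u L : pair23 q1 q2 -> (1 <= u)%nat -> (1 <= L)%nat ->
  (q1 ^ E <= q2 ^ u)%nat -> (q2 ^ (u - 1) < q1 ^ E)%nat ->
  exists J, (q1 ^ (E + 1 + L) <= q2 ^ (u + 1 + J))%nat /\
    (forall k, (q1 ^ (E + 1 + L) <= q2 ^ k)%nat -> (u + 1 + J <= k)%nat) /\
    Rabs (INR J - ln (INR q1) / ln (INR q2) * INR L) <= 2.
Proof.
  intros Hp Hu HL Hu1 Hu2.
  assert (Hq1 : (2 <= q1)%nat) by (destruct Hp; lia). assert (Hq2 : (2 <= q2)%nat) by (destruct Hp; lia).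
  destruct (pair23_ln q1 q2 Hp) as [L1 L12]. destruct (pair23_ln q2 q1 (pair23_sym _ _ Hp)) as [L2 _].
  destruct (least_nat (fun k => (q1 ^ (E + 1 + L) <= q2 ^ k)%nat) (2 * (E + 1 + L))) as [K [HK Hmin]].
  { apply pair23_sq. now apply pair23_sym. }
  assert (HuK : (u + 1 <= K)%nat).
  { destruct (Nat.le_gt_cases (u + 1) K) as [|Hlt]; auto. exfalso.
    assert (q2 ^ K <= q2 ^ u)%nat by (apply Nat.pow_le_mono_r; lia).
    assert (Eu : (q2 ^ u = q2 * q2 ^ (u - 1))%nat) by (rewrite <- Nat.pow_succ_r'; f_equal; lia).
    assert (H4 : (q1 ^ 2 <= q1 ^ (1 + L))%nat) by (apply Nat.pow_le_mono_r; lia).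
    replace (E + 1 + L)%nat with (E + (1 + L))%nat in HK by lia. rewrite Nat.pow_add_r in HK.
    assert (q2 <= 3)%nat by (destruct Hp; lia). rewrite Nat.pow_2_r in H4.
    assert (4 <= q1 ^ (1 + L))%nat by nia. nia. }
  exists (K - (u + 1))%nat. replace (u + 1 + (K - (u + 1)))%nat with K by lia.
  split; [auto|]. split.
  { intros k Hk. destruct (Nat.le_gt_cases K k); auto. exfalso. now apply (Hmin k). }
  assert (HK' : (q2 ^ (K - 1) < q1 ^ (E + 1 + L))%nat).
  { destruct (Nat.le_gt_cases (q1 ^ (E + 1 + L)) (q2 ^ (K - 1))) as [H|]; auto. exfalso.
    apply (Hmin (K - 1)%nat); auto; lia. }
  assert (mono : forall a b, (0 < a)%nat -> (a <= b)%nat -> ln (INR a) <= ln (INR b)).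
  { intros a b Ha Hab. apply le_INR in Hab. apply lt_0_INR in Ha.
    destruct (Rle_lt_or_eq_dec _ _ Hab) as [H|H]; [left; now apply ln_increasing|rewrite H; lra]. }
  apply mono in HK; [|now apply npow_pos]. apply Nat.lt_le_incl, mono in HK'; [|now apply npow_pos].
  apply mono in Hu1; [|now apply npow_pos]. apply Nat.lt_le_incl, mono in Hu2; [|now apply npow_pos].
  rewrite !ln_INR_pow in * by auto. rewrite !plus_INR in *. rewrite !minus_INR in * by lia. rewrite plus_INR.
  simpl (INR 1) in *. set (a := ln (INR q1)) in *. set (b := ln (INR q2)) in *.
  replace (a / b * INR L) with (INR L * a / b) by (field; lra).
  apply Rabs_le. split; apply (Rmult_le_reg_r b); try lra.
  - replace ((INR K - (INR u + 1) - INR L * a / b) * b) with ((INR K - (INR u + 1)) * b - INR L * a) by (field; lra). lra.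
  - replace ((INR K - (INR u + 1) - INR L * a / b) * b) with ((INR K - (INR u + 1)) * b - INR L * a) by (field; lra). lra.
Qed.

(* The blocks q1^R * u_s + v_s have a free low part v_s (averaged over) and a prescribed filler u_s. *)
Lemma sparse_family q1 q2 eps : pair23 q1 q2 -> 0 < eps <= 1 ->
  exists D S0, (1 <= D)%nat /\
    forall E u S K1, (1 <= u)%nat -> (q1 ^ E <= q2 ^ u)%nat -> (q2 ^ (u - 1) < q1 ^ E)%nat ->
      (S0 <= S)%nat -> INR K1 <= (1 - eps) * INR (D * S) ->
      exists n, (n mod q1 ^ (E + 1) = 0)%nat /\
        (K1 <= digit_sum q1 n)%nat /\ INR (digit_sum q1 n) <= INR K1 + eps * INR (D * S) /\
        Rabs (INR (digit_sum q2 ((n + q1 ^ E) / q2 ^ (u + 1)))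
              - (INR q2 - 1) / 2 * (ln (INR q1) / ln (INR q2) * INR (D * S))) <= eps * INR (D * S).
Proof.
  intros Hp He.
  assert (Hq1 : (2 <= q1)%nat) by (destruct Hp; lia). assert (Hq2 : (2 <= q2)%nat) by (destruct Hp; lia).
  assert (Hq13 : (q1 <= 3)%nat) by (destruct Hp; lia).
  assert (Hq23 : INR q2 <= 3) by (replace 3 with (INR 3) by (simpl; lra); apply le_INR; destruct Hp; lia).
  assert (Hq22 : 2 <= INR q2) by (replace 2 with (INR 2) by (simpl; lra); now apply le_INR).
  destruct (pair23_ln q1 q2 Hp) as [L1 L12]. destruct (pair23_ln q2 q1 (pair23_sym _ _ Hp)) as [L2 L21].
  (* This is the square of eps / 8, so a second moment [delta] J^2 yields a deviation eps J / 8. The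
     choices below depend on each other in this order: [q0] for the period sums, [N] for the total
     width of the arcs, [R] to make [N] negligible against [q1 ^ R], [D] to make the random digits
     sparse, [Delta] for the drift, and last [W] and [S0]. *)
  set (delta := eps * eps / 64).
  assert (Hd : 0 < delta <= 1 / 64) by (unfold delta; split; nra).
  destruct (nat_above (54 / delta + 1)) as [q0 Hq0].
  assert (Hq0' : 54 / delta <= INR q0) by lra.
  assert (H54 : 0 < 54 / delta) by (apply Rdiv_lt_0_compat; lra).
  destruct (nat_above (1296 * INR q0 / delta + 12)) as [N HN].
  assert (H1296 : 0 < 1296 * INR q0 / delta) by (apply Rdiv_lt_0_compat; lra).
  destruct (nat_above (9 * INR N / delta)) as [R HR].
  destruct (nat_above (4 * INR R / eps + 2 * (1 + INR q0))) as [D HD].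
  assert (HRe : 0 <= INR R / eps) by (apply Rmult_le_pos; [apply pos_INR|left; apply Rinv_0_lt_compat; lra]).
  assert (HD1 : INR R <= eps / 4 * INR D).
  { apply (Rmult_le_reg_r (4 / eps)); [apply Rdiv_lt_0_compat; lra|].
    replace (INR R * (4 / eps)) with (4 * INR R / eps) by (field; lra).
    replace (eps / 4 * INR D * (4 / eps)) with (INR D) by (field; lra). lra. }
  assert (HD2 : 2 * (1 + INR q0) <= INR D) by lra.
  destruct (nat_above (INR (q1 ^ (2 * D)) * 9 / delta)) as [Delta HDelta].
  set (T := INR D * ln (INR q1)).
  set (alpha := ln (INR q2) / T).
  set (M := (q0 * q1 ^ D)%nat).
  set (eta := fun m => 3 / (INR N * INR (S m) * T)).
  assert (HDn : (1 <= D)%nat) by (destruct D; [simpl in HD2; lra|lia]).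
  assert (Hq0n : (1 <= q0)%nat) by (destruct q0; [simpl in Hq0; lra|lia]).
  assert (HNn : (12 <= N)%nat) by (apply INR_le; replace (INR 12) with 12 by (simpl; lra); lra).
  assert (HT : 1 + INR q0 <= T) by (unfold T; nra).
  assert (Hirr := pair23_irrational q1 q2 D Hp HDn). fold T alpha in Hirr.
  assert (HSm : forall m, 1 <= INR (S m)) by (intros; change 1 with (INR 1); apply le_INR; lia).
  assert (HNT : 12 <= INR N * T) by nra.
  destruct (near_total alpha q0 M eta Hirr) as [W HW].
  { intros m _. specialize (HSm m). assert (12 <= INR N * INR (S m) * T) by nra.
    unfold eta. split; [apply Rdiv_lt_0_compat; lra|].
    apply (Rmult_le_reg_r (INR N * INR (S m) * T)); [lra|]. field_simplify; [lra|]. repeat split; nra. }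
  (* The harmonic sum up to [M] is at most 1 + ln M <= 2T, and [eta] carries a factor 1 / T; the
     spacing cancels and 108 q0 / N remains. *)
  assert (Heta : 18 * INR q0 * rsum eta M <= delta / 12).
  { rewrite (rsum_ext _ (fun m => 3 / (INR N * T) * / INR (S m))).
    2:{ intros m _. specialize (HSm m). unfold eta. field. repeat split; nra. }
    rewrite rsum_scal.
    assert (HM : (1 <= M)%nat) by (unfold M; pose proof (npow_pos q1 D Hq1); nia).
    pose proof (harmonic_le M HM) as Hh.
    assert (HlM : ln (INR M) <= INR q0 + T).
    { unfold M. rewrite mult_INR, ln_mult by (apply lt_0_INR; first [lia | now apply npow_pos]).
      rewrite ln_INR_pow by auto. fold T. pose proof (ln_pred_le (INR q0) ltac:(lra)). lra. }
    apply Rle_trans with (18 * INR q0 * (3 / (INR N * T) * (2 * T))).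
    - apply Rmult_le_compat_l; [lra|]. apply Rmult_le_compat_l; [left; apply Rdiv_lt_0_compat; lra|lra].
    - replace (18 * INR q0 * (3 / (INR N * T) * (2 * T))) with (108 * INR q0 / INR N) by (field; repeat split; lra).
      apply (Rmult_le_reg_r (INR N * 12 / delta)); [apply Rdiv_lt_0_compat; lra|].
      replace (108 * INR q0 / INR N * (INR N * 12 / delta)) with (1296 * INR q0 / delta) by (field; repeat split; lra).
      replace (delta / 12 * (INR N * 12 / delta)) with (INR N) by (field; lra). lra. }
  set (J0 := 6 * INR Delta / delta + 12 * (Rabs W + 2 * INR D + 3) / delta).
  destruct (nat_above (8 / eps + 2 * (J0 + 2))) as [S0 HS0].
  assert (H8e : 8 <= 8 / eps).
  { apply (Rmult_le_reg_r eps); [lra|]. field_simplify; lra. }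
  assert (HJ0a : 0 <= 6 * INR Delta / delta).
  { apply Rmult_le_pos; [pose proof (pos_INR Delta); lra|left; apply Rinv_0_lt_compat; lra]. }
  assert (HJ0b : 0 <= 12 * (Rabs W + 2 * INR D + 3) / delta).
  { apply Rmult_le_pos; [pose proof (Rabs_pos W); pose proof (pos_INR D); lra|left; apply Rinv_0_lt_compat; lra]. }
  assert (HJ0 : 0 <= J0) by (unfold J0; lra).
  exists D, S0. split; [auto|].
  intros E u S K1 Hu Hu1 Hu2 HS HK1.
  assert (HDS : 8 / eps + 2 * (J0 + 2) <= INR (D * S)).
  { eapply Rle_trans; [exact HS0|]. apply le_INR. nia. }
  assert (HSn : (1 <= S)%nat).
  { destruct S; [|lia]. rewrite Nat.mul_0_r in HDS. simpl in HDS. lra. }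
  destruct (sparse_length q1 q2 E u (D * S) Hp Hu ltac:(nia) Hu1 Hu2) as [J [HJ1 [HJ2 HJ3]]].
  set (lam := ln (INR q1) / ln (INR q2)) in *.
  assert (Hlam : 1 / 2 <= lam <= 2).
  { unfold lam. split; apply (Rmult_le_reg_r (ln (INR q2))); try lra; field_simplify; lra. }
  apply Rabs_le_elim in HJ3.
  set (L := INR (D * S)) in *.
  assert (HL0 : 0 <= L) by apply pos_INR.
  assert (HlL1 : 1 / 2 * L <= lam * L) by (apply Rmult_le_compat_r; lra).
  assert (HlL2 : lam * L <= 2 * L) by (apply Rmult_le_compat_r; lra).
  assert (HJlow : J0 <= INR J) by lra.
  assert (HJup : INR J <= 2 * L + 2) by lra.
  pose proof (pos_INR D) as HD0. pose proof (pos_INR S) as HS0'.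
  assert (HeD : 0 <= eps * INR D) by (apply Rmult_le_pos; lra).
  assert (HeD1 : eps * INR D <= 1 * INR D) by (apply Rmult_le_compat_r; lra).
  assert (HRD : (R <= D)%nat) by (apply INR_le; lra).
  destruct (digit_sum_fillers q1 (D - R) S K1 Hq1) as [w [Hw Dw]].
  { apply INR_le. eapply Rle_trans; [exact HK1|]. unfold L. rewrite !mult_INR, minus_INR by auto.
    rewrite <- Rmult_assoc. apply Rmult_le_compat_r; lra. }
  set (g := fun s => (q1 ^ (E + 1 + D * s))%nat).
  set (V := (q1 ^ R)%nat).
  assert (HVp : (0 < V)%nat) by now apply npow_pos.
  set (U := (u + 1)%nat) in *.
  set (f := fun j y => saw (INR y / INR (q2 ^ (U + 1 + j)))).
  set (c := fun d m => ((INR (E + 1) * ln (INR q1) + ln (INR (Datatypes.S d)) - ln (INR (Datatypes.S m))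
                         - INR (U + 1) * ln (INR q2)) / T)).
  set (arcs := fun j => rsum (fun d => rsum (fun m => indic (near (eta m) (INR j * alpha - c d m))) M) q0).
  set (bad := fun j => indic (J <=? j + 2 * D + 2)%nat + arcs j).
  assert (Harcs0 : forall j, 0 <= arcs j).
  { intros j. apply rsum_nonneg; intros; apply rsum_nonneg; intros; apply indic_nonneg. }
  set (e1 := delta / 3).
  (* The base point includes [q1 ^ E] because [dense_correction] asks for the high digits of
     [n + q1 ^ E] rather than of [n]. *)
  assert (Hmom := second_moment g V S J Delta f bad e1
                   (q1 ^ E + nsum (fun s => q1 ^ R * w s * g s) S)%nat HVp).
  assert (Hmom' : av g V S (fun y => rsum (fun j => f j y) J * rsum (fun j => f j y) J)
       (q1 ^ E + nsum (fun s => q1 ^ R * w s * g s) S)%nat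
     <= e1 * INR J * INR J + 2 * INR Delta * INR J + 2 * INR J * rsum bad J).
  { apply Hmom.
    - unfold e1; lra.
    - intros; apply saw_bound.
    - intros j. unfold bad. pose proof (indic_nonneg (J <=? j + 2 * D + 2)%nat). specialize (Harcs0 j). lra.
    - intros j j' Hjj' Hj' Hbad.
      unfold bad in Hbad.
      destruct (Nat.leb_spec J (j + 2 * D + 2)) as [Hle|Hlt]; cbn [indic] in Hbad; [specialize (Harcs0 j); lra|].
      destruct (good_position q1 q2 D R E U S J q0 N Delta (delta / 9) j j') as [s [Hs Hgood]]; auto; try lia; try lra.
      + assert (q2 ^ u * q2 = q2 ^ U)%nat by (unfold U; rewrite Nat.add_1_r, Nat.pow_succ_r'; ring).
        rewrite Nat.add_1_r, Nat.pow_succ_r'.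
        assert (q1 ^ 1 <= q1 ^ D)%nat by (apply Nat.pow_le_mono_r; lia). rewrite Nat.pow_1_r in H0.
        pose proof (npow_pos q1 E Hq1). nia.
      + pose proof (pow_ge_exponent q2 Delta Hq2) as HpD.
        apply (Rmult_le_reg_r (9 / delta)); [apply Rdiv_lt_0_compat; lra|].
        replace (INR (q1 ^ (2 * D)) * (9 / delta)) with (INR (q1 ^ (2 * D)) * 9 / delta) by (field; lra).
        replace (delta / 9 * INR (q2 ^ Delta) * (9 / delta)) with (INR (q2 ^ Delta)) by (field; lra). lra.
      + intros d m Hd1 Hm1.
        match goal with |- ?b = false => destruct b eqn:Eb; [exfalso|reflexivity] end.
        destruct d as [|d]; [lia|]. destruct m as [|m]; [lia|].
        assert (H1 : indic (near (eta m) (INR j * alpha - c d m)) <= arcs j).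
        { unfold arcs.
          apply Rle_trans with (rsum (fun m => indic (near (eta m) (INR j * alpha - c d m))) M).
          - apply (rsum_term_le (fun m => indic (near (eta m) (INR j * alpha - c d m)))); [intros; apply indic_nonneg|unfold M; lia].
          - apply (rsum_term_le (fun d => rsum (fun m => indic (near (eta m) (INR j * alpha - c d m))) M)); [|lia].
            intros; apply rsum_nonneg; intros; apply indic_nonneg. }
        unfold eta, alpha, c, T in H1. rewrite Eb in H1. cbn [indic] in H1. lra.
      + exists s. split; auto. intros y. eapply Rle_trans; [apply Hgood|].
        fold V. assert (HVN : 9 * INR N / delta <= INR V).
        { eapply Rle_trans; [exact HR|]. now apply pow_ge_exponent. }
        apply (Rmult_le_compat_r delta) in HVN; [|lra].
        replace (9 * INR N / delta * delta) with (9 * INR N) in HVN by (field; lra).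
        assert (H6 : 6 / INR q0 <= delta / 9).
        { apply (Rmult_le_reg_r (INR q0 * 9 / delta)); [apply Rdiv_lt_0_compat; lra|].
          replace (6 / INR q0 * (INR q0 * 9 / delta)) with (54 / delta) by (field; repeat split; lra).
          replace (delta / 9 * (INR q0 * 9 / delta)) with (INR q0) by (field; lra). lra. }
        replace (6 * INR V / INR q0) with (INR V * (6 / INR q0)) by (field; lra).
        pose proof (pos_INR V). unfold e1. nra. }
  clear Hmom.
  assert (Hbadsum : rsum bad J <= delta / 12 * INR J + (Rabs W + 2 * INR D + 3)).
  { unfold bad. rewrite rsum_plus.
    assert (A1 : rsum (fun j => indic (J <=? j + 2 * D + 2)%nat) J <= INR (2 * D + 3)).
    { apply (count_close (fun j => (J <=? j + 2 * D + 2)%nat)). intros a b Hab Ha Hb.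
      apply Nat.leb_le in Ha, Hb. lia. }
    specialize (HW c J). pose proof (Rle_abs W). pose proof (pos_INR J).
    assert (18 * INR q0 * rsum eta M * INR J <= delta / 12 * INR J) by (apply Rmult_le_compat_r; auto).
    eapply Rle_trans; [apply Rplus_le_compat; [exact A1|exact HW]|].
    rewrite plus_INR, mult_INR. simpl (INR 2). simpl (INR 3). lra. }
  assert (Hfin : av g V S (fun y => rsum (fun j => f j y) J * rsum (fun j => f j y) J)
       (q1 ^ E + nsum (fun s => q1 ^ R * w s * g s) S)%nat <= delta * INR J * INR J).
  { eapply Rle_trans; [exact Hmom'|].
    assert (B1 : 6 * INR Delta <= delta * INR J).
    { apply (Rmult_le_reg_r (/ delta)); [apply Rinv_0_lt_compat; lra|].
      replace (delta * INR J * / delta) with (INR J) by (field; lra). unfold J0, Rdiv in *. lra. }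
    assert (B2 : 12 * (Rabs W + 2 * INR D + 3) <= delta * INR J).
    { apply (Rmult_le_reg_r (/ delta)); [apply Rinv_0_lt_compat; lra|].
      replace (delta * INR J * / delta) with (INR J) by (field; lra). unfold J0, Rdiv in *. lra. }
    pose proof (pos_INR J). unfold e1.
    assert (B3 : rsum bad J <= delta / 6 * INR J) by lra.
    apply (Rmult_le_compat_r (INR J)) in B1; [|auto]. apply (Rmult_le_compat_r (INR J)) in B3; [|auto]. lra. }
  destruct (av_attained g V S (fun y => rsum (fun j => f j y) J * rsum (fun j => f j y) J)
       (q1 ^ E + nsum (fun s => q1 ^ R * w s * g s) S)%nat HVp) as [v [Hv Hsq]].
  set (a := fun s => (w s * q1 ^ R + v s)%nat).
  set (n := nsum (fun s => a s * g s)%nat S).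
  assert (Ey : (q1 ^ E + nsum (fun s => q1 ^ R * w s * g s) S + nsum (fun s => v s * g s) S = n + q1 ^ E)%nat).
  { unfold n, a. rewrite (nsum_ext (fun s => (w s * q1 ^ R + v s) * g s)%nat (fun s => q1 ^ R * w s * g s + v s * g s)%nat) by (intros; ring).
    rewrite nsum_plus. lia. }
  rewrite Ey in Hsq.
  assert (Ha : forall s, (s < S)%nat -> (a s < q1 ^ D)%nat).
  { intros s Hs. unfold a. specialize (Hw s Hs). specialize (Hv s Hs). unfold V in Hv.
    replace D with (D - R + R)%nat by lia. rewrite Nat.pow_add_r. nia. }
  destruct (digit_sum_blocks q1 D (E + 1) a S Hq1 Ha) as [Bl1 Bl2].
  change (fun l => (a l * q1 ^ (E + 1 + D * l))%nat) with (fun s => (a s * g s)%nat) in Bl1, Bl2.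
  fold n in Bl1, Bl2.
  assert (Hda : forall s, (s < S)%nat -> digit_sum q1 (a s) = (digit_sum q1 (w s) + digit_sum q1 (v s))%nat).
  { intros s Hs. unfold a. apply digit_sum_app; auto. }
  rewrite (nsum_ext _ _ S Hda), nsum_plus, Dw in Bl2.
  assert (Hvb : (nsum (fun s => digit_sum q1 (v s)) S <= S * (2 * R))%nat).
  { apply nsum_bound. intros s Hs. eapply Nat.le_trans; [apply (digit_sum_bound q1 R (v s) Hq1 (Hv s Hs))|].
    apply Nat.mul_le_mono_r. lia. }
  exists n. split; [|split; [|split]].
  - apply nsum_multiple. intros i. exists (a i * q1 ^ (D * i))%nat. unfold g.
    rewrite (Nat.pow_add_r q1 (E + 1)). ring.
  - lia.
  - rewrite Bl2, plus_INR. apply le_INR in Hvb. rewrite !mult_INR in Hvb. simpl (INR 2) in Hvb.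
    unfold L. rewrite mult_INR.
    apply (Rmult_le_compat_l (INR S)) in HD1; [|auto]. apply (Rmult_le_compat_l (INR S)) in HeD; [|auto]. lra.
  - assert (HNlt : (n + q1 ^ E < q2 ^ (U + J))%nat).
    { eapply Nat.lt_le_trans; [|exact HJ1].
      assert (q1 ^ E < q1 ^ (E + 1))%nat by (apply Nat.pow_lt_mono_r; lia). lia. }
    rewrite (digit_sum_frac q2 _ U J Hq2 HNlt).
    pose proof (frac_part_bounds (INR (n + q1 ^ E) / INR (q2 ^ (U + J)))) as F1.
    pose proof (frac_part_bounds (INR (n + q1 ^ E) / INR (q2 ^ U))) as F2.
    set (f1 := frac_part (INR (n + q1 ^ E) / INR (q2 ^ (U + J)))) in *.
    set (f2 := frac_part (INR (n + q1 ^ E) / INR (q2 ^ U))) in *.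
    rewrite (rsum_ext _ (fun j => f j (n + q1 ^ E)%nat + 1 / 2)) by (intros; unfold f, saw; lra).
    rewrite rsum_plus, rsum_const.
    set (Sg := rsum (fun j => f j (n + q1 ^ E)%nat) J) in *.
    assert (HSg : - (eps / 8 * INR J) <= Sg <= eps / 8 * INR J).
    { pose proof (pos_INR J). assert (0 <= eps / 8 * INR J) by (apply Rmult_le_pos; lra).
      assert (Sg * Sg <= (eps / 8 * INR J) * (eps / 8 * INR J)).
      { eapply Rle_trans; [exact Hsq|]. eapply Rle_trans; [exact Hfin|]. unfold delta. lra. }
      clear - H0 H1. split; nra. }
    assert (HeL : 8 <= eps * L).
    { apply Rle_trans with (eps * (8 / eps)); [apply Req_le; field; lra|]. apply Rmult_le_compat_l; lra. }
    assert (HeJ : eps * INR J <= 2 * (eps * L) + 2).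
    { apply (Rmult_le_compat_l eps) in HJup; lra. }
    assert (HSg2 : - (eps * L / 4 + 1 / 4) <= Sg <= eps * L / 4 + 1 / 4) by lra.
    replace ((INR q2 - 1) * (Sg + INR J * (1 / 2)) + f1 - f2 - (INR q2 - 1) / 2 * (lam * L))
      with ((INR q2 - 1) * (Sg + (INR J - lam * L) / 2) + (f1 - f2)) by field.
    set (Z := Sg + (INR J - lam * L) / 2).
    assert (HZ : - (eps * L / 4 + 5 / 4) <= Z <= eps * L / 4 + 5 / 4) by (unfold Z; lra).
    assert (HB : 0 <= eps * L / 4 + 5 / 4) by lra.
    assert (HqZ : - (2 * (eps * L / 4 + 5 / 4)) <= (INR q2 - 1) * Z <= 2 * (eps * L / 4 + 5 / 4)).
    { generalize dependent (eps * L / 4 + 5 / 4). intros B HZ HB. clear - HZ HB Hq22 Hq23. split; nra. }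
    apply Rabs_le. lra.
Qed.

(** * Assembly *)

(** The two values are ln 2 / ln 3 = 0.63... and ln 3 / (2 ln 2) = 0.79...; the second rests on 3^5
    < 2^8. An upper bound below 1 is what makes the number of base-[q1] digits exceed the larger
    target. *)
Lemma pair23_density q1 q2 : pair23 q1 q2 ->
  1 / 2 <= (INR q2 - 1) / 2 * (ln (INR q1) / ln (INR q2)) <= 4 / 5.
Proof.
  intros Hp.
  assert (L2 := ln_lt_2).
  assert (L23 : ln 2 < ln 3) by (apply ln_increasing; lra).
  assert (L34 : ln 3 < 2 * ln 2).
  { replace (2 * ln 2) with (INR 2 * ln 2) by (simpl; lra). rewrite <- ln_pow by lra. apply ln_increasing; simpl; lra. }
  assert (L5 : 5 * ln 2 < 4 * ln 3).
  { replace 5 with (INR 5) by (simpl; lra). replace 4 with (INR 4) by (simpl; lra).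
    rewrite <- !ln_pow by lra. apply ln_increasing; simpl; lra. }
  assert (L8 : 5 * ln 3 < 8 * ln 2).
  { replace 5 with (INR 5) by (simpl; lra). replace 8 with (INR 8) by (simpl; lra).
    rewrite <- !ln_pow by lra. apply ln_increasing; simpl; lra. }
  assert (E2 : INR 2 = 2) by (simpl; lra). assert (E3 : INR 3 = 3) by (simpl; lra).
  destruct Hp as [[-> ->]|[-> ->]]; rewrite E2, E3.
  - split; apply (Rmult_le_reg_r (ln 3)); try lra; field_simplify; lra.
  - split; apply (Rmult_le_reg_r (ln 2)); try lra; field_simplify; lra.
Qed.

Lemma pow_bracket x : 1 <= x -> exists s, INR (20 ^ s) <= x < 20 * INR (20 ^ s).
Proof.
  intros Hx.
  destruct (nat_above x) as [n Hn].
  destruct (least_nat (fun s => x < 20 * INR (20 ^ s)) n) as [s [Hs Hmin]].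
  { pose proof (pow_ge_exponent 20 n ltac:(lia)). lra. }
  exists s. split; auto. destruct s as [|s]; [simpl; lra|].
  specialize (Hmin s ltac:(lia)). rewrite Nat.pow_succ_r', mult_INR.
  replace (INR 20) with 20 by (simpl; lra). lra.
Qed.

Lemma box_pair q1 q2 c w : pair23 q1 q2 -> box c w ->
  exists A1 A2, forall i j, (i < w)%nat -> (j < w)%nat ->
    exists r, (r < 2 ^ c)%nat /\ digit_sum q1 r = (A1 + i)%nat /\ digit_sum q2 r = (A2 + j)%nat.
Proof.
  intros Hp [A [B HAB]]. destruct Hp as [[-> ->]|[-> ->]]; [exists A, B|exists B, A]; intros i j Hi Hj.
  - destruct (HAB i j Hi ltac:(lia)) as [r Hr]. exists r; tauto.
  - destruct (HAB j i Hj ltac:(lia)) as [r Hr]. exists r; tauto.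
Qed.

Lemma pair_case q1 q2 delta : pair23 q1 q2 -> 0 < delta <= 1 ->
  exists K0, forall k1 k2 : nat, K0 <= INR k2 -> delta * INR k2 <= INR k1 -> INR k1 <= INR k2 ->
    exists n, digit_sum q1 n = k1 /\ digit_sum q2 n = k2.
Proof.
  intros Hp Hdelta.
  assert (Hq1 : (2 <= q1)%nat) by (destruct Hp; lia). assert (Hq2 : (2 <= q2)%nat) by (destruct Hp; lia).
  assert (Hq13 : (q1 <= 3)%nat) by (destruct Hp; lia). assert (Hq23 : (q2 <= 3)%nat) by (destruct Hp; lia).
  destruct (pair23_density q1 q2 Hp) as [Hr1 Hr2].
  set (rho := (INR q2 - 1) / 2 * (ln (INR q1) / ln (INR q2))) in *.
  destruct box_all as [c0 [Hc0 Hbox]].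
  assert (Hc0' : 1 <= INR c0) by (change 1 with (INR 1); now apply le_INR).
  (* Since [c] will be at most [kappa] k2 and k1 is at least 1000 [kappa] k2, the offsets of box and
     correction, below 20 c in either base, are negligible against both targets. *)
  set (kappa := delta / 1000).
  assert (Hkap : 0 < kappa <= 1 / 1000) by (unfold kappa; lra).
  (* With L <= 2 k2 and [kappa] k2 <= 20 c this gives [eps] L <= w / 8. *)
  set (eps := kappa / (320 * INR c0)).
  assert (Heps : 0 < eps <= 1 / 320000).
  { unfold eps. split; [apply Rdiv_lt_0_compat; lra|].
    apply (Rmult_le_reg_r (320 * INR c0)); [lra|]. unfold Rdiv. rewrite (Rmult_assoc kappa), Rinv_l by lra. lra. }
  destruct (sparse_family q1 q2 eps Hp ltac:(lra)) as [D [S0 [HD Hfam]]].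
  (* The first term turns the deviation 100 sqrt c into at most w / 4; the others pay for rounding
     the length to a multiple of [D] and for integer parts. *)
  set (Wmin := 160000 * INR c0 + 8 * INR D + 16).
  exists (20 * INR c0 * Wmin / kappa + 5 * INR D + INR (D * S0)).
  intros k1 k2 Hk2 Hk1 Hk12.
  pose proof (pos_INR D) as HD0. pose proof (pos_INR (D * S0)) as HDS0.
  assert (HWm : 160016 <= Wmin) by (unfold Wmin; lra).
  assert (HK : 0 <= 20 * INR c0 * Wmin / kappa).
  { apply Rmult_le_pos; [apply Rmult_le_pos; lra|left; apply Rinv_0_lt_compat; lra]. }
  assert (Hx : 20 * Wmin <= kappa * INR k2 / INR c0).
  { apply (Rmult_le_reg_r (INR c0 / kappa)); [apply Rdiv_lt_0_compat; lra|].
    replace (kappa * INR k2 / INR c0 * (INR c0 / kappa)) with (INR k2) by (field; split; lra).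
    replace (20 * Wmin * (INR c0 / kappa)) with (20 * INR c0 * Wmin / kappa) by (field; lra). lra. }
  destruct (pow_bracket (kappa * INR k2 / INR c0) ltac:(lra)) as [s [Hs1 Hs2]].
  specialize (Hbox s). set (w := (20 ^ s)%nat) in *. set (c := (w * c0)%nat) in *.
  assert (Hw : Wmin < INR w) by lra.
  assert (Hc : INR c = INR w * INR c0) by (unfold c; apply mult_INR).
  assert (Hck : INR c <= kappa * INR k2).
  { rewrite Hc. apply (Rmult_le_compat_r (INR c0)) in Hs1; [|lra].
    replace (kappa * INR k2 / INR c0 * INR c0) with (kappa * INR k2) in Hs1 by (field; lra). lra. }
  assert (Hkw : kappa * INR k2 <= 20 * INR c).
  { rewrite Hc. apply Rlt_le, (Rmult_le_compat_r (INR c0)) in Hs2; [|lra].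
    replace (kappa * INR k2 / INR c0 * INR c0) with (kappa * INR k2) in Hs2 by (field; lra). lra. }
  assert (Hwc : INR w <= INR c).
  { rewrite Hc, <- (Rmult_1_r (INR w)) at 1. apply Rmult_le_compat_l; lra. }
  assert (Hc2 : (2 <= c)%nat) by (apply INR_le; simpl (INR 2); lra).
  destruct (box_pair q1 q2 c w Hp Hbox) as [A1 [A2 HA]].
  assert (Hwp : (0 < w)%nat) by (apply INR_lt; simpl; lra).
  assert (Hpow : forall q, (2 <= q)%nat -> (2 ^ c <= q ^ c)%nat) by (intros; now apply Nat.pow_le_mono_l).
  assert (HA12 : INR A1 <= 2 * INR c /\ INR A2 <= 2 * INR c).
  { destruct (HA O O Hwp Hwp) as [r [Hr [R1 R2]]].
    pose proof (digit_sum_bound q1 c r Hq1 ltac:(specialize (Hpow q1 Hq1); lia)).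
    pose proof (digit_sum_bound q2 c r Hq2 ltac:(specialize (Hpow q2 Hq2); lia)).
    assert (HH1 : ((q1 - 1) * c <= 2 * c)%nat) by (apply Nat.mul_le_mono_r; lia).
    assert (HH2 : ((q2 - 1) * c <= 2 * c)%nat) by (apply Nat.mul_le_mono_r; lia).
    assert (HH : (A1 <= 2 * c /\ A2 <= 2 * c)%nat).
    { rewrite R1 in *. rewrite R2 in *. rewrite Nat.add_0_r in *. split; eapply Nat.le_trans; eauto. }
    clear HH1 HH2.
    destruct HH as [HH1 HH2]. apply le_INR in HH1, HH2. rewrite mult_INR in HH1, HH2. simpl (INR 2) in *. lra. }
  destruct HA12 as [HA1 HA2].
  destruct (least_nat (fun u => (q1 ^ (8 * c) <= q2 ^ u)%nat) (2 * (8 * c))) as [u [Hu1 Humin]].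
  { apply pair23_sq. now apply pair23_sym. }
  assert (H1p : (q1 ^ 1 <= q1 ^ (8 * c))%nat) by (apply Nat.pow_le_mono_r; lia).
  rewrite Nat.pow_1_r in H1p.
  assert (Hu : (1 <= u)%nat) by (destruct u; [rewrite Nat.pow_0_r in Hu1; lia|lia]).
  assert (Hu2 : (q2 ^ (u - 1) < q1 ^ (8 * c))%nat).
  { destruct (Nat.le_gt_cases (q1 ^ (8 * c)) (q2 ^ (u - 1))) as [H|]; auto. exfalso. apply (Humin (u - 1)%nat); auto; lia. }
  assert (Hu17 : (u + 1 - c <= 17 * c)%nat).
  { destruct (Nat.le_gt_cases u (2 * (8 * c))) as [|H]; [lia|]. exfalso.
    apply (Humin (2 * (8 * c))%nat H). apply pair23_sq. now apply pair23_sym. }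
  set (m1 := INR (q1 - 1) * INR (7 * c)). set (m2 := INR (q2 - 1) * INR (u + 1 - c)).
  assert (Hm1 : 0 <= m1 <= 14 * INR c).
  { unfold m1. rewrite <- mult_INR. split; [apply pos_INR|].
    replace 14 with (INR 14) by (simpl; lra). rewrite <- mult_INR. apply le_INR. nia. }
  assert (Hm2 : 0 <= m2 <= 34 * INR c).
  { unfold m2. rewrite <- mult_INR. split; [apply pos_INR|].
    replace 34 with (INR 34) by (simpl; lra). rewrite <- mult_INR. apply le_INR. nia. }
  assert (Hk20 : 1000 * kappa * INR k2 <= INR k1) by (unfold kappa; lra).
  pose proof (pos_INR A1) as HA10. pose proof (pos_INR A2) as HA20.
  (* The aim is the middle of the box, hence w / 2, after the mean m1 / 2 of the correction; errors
     of either sign then stay inside. The same is done for [y]. *)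
  destruct (floor_nat (INR k1 - INR A1 - m1 / 2 - INR w / 2) ltac:(lra)) as [K1 HK1].
  assert (Hkk : kappa * INR k2 <= 1 / 1000 * INR k2) by (apply Rmult_le_compat_r; [apply pos_INR|lra]).
  set (y := INR k2 - INR A2 - m2 / 2 - INR w / 2) in *.
  assert (Hy : 98 / 100 * INR k2 <= y <= INR k2) by (unfold y; lra).
  assert (HDp : 1 <= INR D) by (change 1 with (INR 1); now apply le_INR).
  assert (HrD : 0 < rho * INR D) by (apply Rmult_lt_0_compat; lra).
  destruct (floor_nat (y / (rho * INR D))) as [S [HS1 HS2]].
  { apply Rmult_le_pos; [pose proof (pos_INR k2); lra|left; now apply Rinv_0_lt_compat]. }
  set (L := INR (D * S)).
  assert (HL : L = INR D * INR S) by apply mult_INR.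
  assert (HL1 : rho * L <= y).
  { apply (Rmult_le_compat_r (rho * INR D)) in HS1; [|lra].
    replace (y / (rho * INR D) * (rho * INR D)) with y in HS1 by (field; split; lra). rewrite HL. lra. }
  assert (HL2 : y < rho * L + rho * INR D).
  { apply (Rmult_lt_compat_r (rho * INR D)) in HS2; [|lra].
    replace (y / (rho * INR D) * (rho * INR D)) with y in HS2 by (field; split; lra). rewrite HL. lra. }
  assert (HLp : 0 <= L) by apply pos_INR.
  assert (HrL1 : 1 / 2 * L <= rho * L) by (apply Rmult_le_compat_r; lra).
  assert (HrL2 : rho * L <= 4 / 5 * L) by (apply Rmult_le_compat_r; lra).
  assert (HrD' : rho * INR D <= 4 / 5 * INR D) by (apply Rmult_le_compat_r; lra).
  assert (HeL' : eps * L <= 1 / 320000 * L) by (apply Rmult_le_compat_r; lra).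
  assert (HLup : L <= 2 * INR k2) by lra.
  assert (HLlow : 98 / 100 * INR k2 <= 4 / 5 * L + 4 / 5 * INR D) by lra.
  assert (HeL : eps * L <= INR w / 8).
  { apply Rle_trans with (eps * (2 * INR k2)); [apply Rmult_le_compat_l; lra|].
    unfold eps. apply (Rmult_le_reg_r (160 * INR c0)); [lra|].
    replace (kappa / (320 * INR c0) * (2 * INR k2) * (160 * INR c0)) with (kappa * INR k2) by (field; lra).
    rewrite Hc in Hkw. lra. }
  (* Here the density bound 4/5 pays off: L is at least (98/100) (5/4) k2 - D, and 5 D <= k2, so L
     exceeds k2 >= k1 with room for [eps]. *)
  assert (HK1L : INR K1 <= (1 - eps) * L) by lra.
  assert (HS0 : (S0 <= S)%nat).
  { assert (HDS : INR (D * S0) <= INR (D * S)) by (fold L; lra).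
    apply INR_le in HDS. nia. }
  destruct (Hfam (8 * c)%nat u S K1 Hu Hu1 Hu2 HS0 HK1L) as [n [Hn [Hn1 [Hn2 Hn3]]]].
  destruct (dense_correction q1 q2 c u n Hp Hc2 Hu Hu1 Hu2 Hn) as [M [s1 [s2 [HM2 [HM3 [HMs1 [HMs2 [Hs1' Hs2']]]]]]]].
  fold m1 in Hs1'. fold m2 in Hs2'. fold L in Hn2, Hn3.
  replace ((INR q2 - 1) / 2 * (ln (INR q1) / ln (INR q2) * L)) with (rho * L) in Hn3 by (unfold rho; ring).
  apply Rabs_le_elim in Hn3.
  assert (Hroot : forall z, z ^ 2 <= 10000 * INR c -> - (INR w / 4) <= z <= INR w / 4).
  { intros z Hz.
    assert (z * z <= (INR w / 4) * (INR w / 4)).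
    { replace (z * z) with (z ^ 2) by ring. eapply Rle_trans; [exact Hz|]. rewrite Hc. unfold Wmin in Hw.
      assert (160000 * INR c0 * INR w <= INR w * INR w) by (apply Rmult_le_compat_r; lra). lra. }
    assert (0 < INR w / 4) by lra. clear - H H0. split; nra. }
  apply Hroot in Hs1', Hs2'. clear Hroot.
  apply (f_equal INR) in HMs1, HMs2. rewrite plus_INR in HMs1, HMs2.
  set (d2 := INR (digit_sum q2 ((n + q1 ^ (8 * c)) / q2 ^ (u + 1)))) in *.
  set (d1 := INR (digit_sum q1 n)) in *.
  apply le_INR in Hn1. fold d1 in Hn1.
  unfold Wmin in Hw.
  assert (Hi : (A1 + digit_sum q1 M <= k1 /\ k1 < A1 + digit_sum q1 M + w)%nat).
  { split; [apply INR_le|apply INR_lt]; rewrite ?plus_INR, HMs1; lra. }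
  assert (Hj : (A2 + digit_sum q2 M <= k2 /\ k2 < A2 + digit_sum q2 M + w)%nat).
  { unfold y in *. split; [apply INR_le|apply INR_lt]; rewrite ?plus_INR, HMs2; lra. }
  destruct (HA (k1 - (A1 + digit_sum q1 M))%nat (k2 - (A2 + digit_sum q2 M))%nat) as [r [Hr [R1 R2]]]; [lia|lia|].
  assert (HMq : (M mod q1 ^ c = 0 /\ M mod q2 ^ c = 0)%nat) by (destruct Hp as [[-> ->]|[-> ->]]; auto).
  exists (M + r)%nat. split; rewrite (digit_sum_add_low _ c); try tauto; try lia.
  - specialize (Hpow q1 Hq1). lia.
  - specialize (Hpow q2 Hq2). lia.
Qed.

Theorem theorem2 :
  forall delta : R, 0 < delta ->
  exists K0 : R, 0 < K0 /\
    forall k1 k2 : nat,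
      K0 <= INR k1 -> K0 <= INR k2 ->
      delta * INR k2 <= INR k1 -> delta * INR k1 <= INR k2 ->
      exists n : nat, digit_sum 2 n = k1 /\ digit_sum 3 n = k2.
Proof.
  intros delta Hdelta.
  set (d := Rmin delta 1).
  assert (Hd : 0 < d <= 1) by (unfold d; split; [apply Rmin_pos; lra|apply Rmin_r]).
  assert (Hdd : d <= delta) by apply Rmin_l.
  destruct (pair_case 2 3 d) as [Ka HKa]; [now left|auto|].
  destruct (pair_case 3 2 d) as [Kb HKb]; [now right|auto|].
  exists (Rmax 1 (Rmax Ka Kb)).
  pose proof (Rmax_l 1 (Rmax Ka Kb)). pose proof (Rmax_r 1 (Rmax Ka Kb)).
  pose proof (Rmax_l Ka Kb). pose proof (Rmax_r Ka Kb).
  split; [lra|]. intros k1 k2 Hk1 Hk2 H12 H21.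
  assert (d * INR k1 <= delta * INR k1) by (apply Rmult_le_compat_r; [apply pos_INR|auto]).
  assert (d * INR k2 <= delta * INR k2) by (apply Rmult_le_compat_r; [apply pos_INR|auto]).
  destruct (Rle_dec (INR k1) (INR k2)) as [Hle|Hgt].
  - apply HKa; lra.
  - destruct (HKb k2 k1) as [n Hn]; [lra..|]. exists n; tauto.
Qed.
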